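(* The only positive integer $N$ divisible by $27=3^3$ with $\sigma^{**}(N)=3N$ is $N=2160$.
   Context: A divisor $d$ of a positive integer $n$ is a unitary divisor if $\gcd(d,n/d)=1$. For positive integers $a,b$, $\gcd_1(a,b)$ denotes the greatest common unitary divisor of $a$ and $b$ (the largest $d$ which is a unitary divisor of both $a$ and $b$). A divisor $d$ of $N$ is a biunitary divisor if $\gcd_1(d,N/d)=1$. $\sigma^{**}(N)$ denotes the sum of the biunitary divisors of $N$. (A positive integer $N$ with $\sigma^{**}(N)=3N$ is called biunitary triperfect.) *)

(* Defs.v *)
From mathcomp Require Export all_boot.

Set Implicit Arguments.
Unset Strict Implicit.
Unset Printing Implicit Defensive.

Definition unitary_divisor (d n : nat) : bool :=
  (d %| n) && coprime d (n %/ d).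

(* Meaningful for a, b > 0: then 1 is always a common unitary divisor, so the
   maximum is attained. *)
Definition gcd1 (a b : nat) : nat :=
  \max_(d <- divisors a | unitary_divisor d a && unitary_divisor d b) d.

Definition biunitary_divisor (d n : nat) : bool :=
  (d %| n) && (gcd1 d (n %/ d) == 1).

(* Written sigma^{**}(n); meaningful for n > 0. *)
Definition sigma_biunitary (n : nat) : nat :=
  \sum_(d <- divisors n | biunitary_divisor d n) d.

(* Main.v *)
Require Import Defs.
From mathcomp Require Import all_boot cyclic zify.

(** Write [sigma] for [sigma_biunitary], [h n = sigma n / n], and
    [N = 2 ^ a * 3 ^ b * M] with [M] prime to 6, so that [h N = 3].  If
    [p] is prime, [sigma (p ^ e)] factors as a repunit [1 + p + ... + p ^ (m - 1)]
    times [p ^ m + 1] ([e = 2m - 1]) or [p ^ (m + 1) + 1] ([e = 2m]); it is even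
    for odd [p], hence [N] has at most [a] odd prime divisors.  Moreover
    [h (p ^ e) >= 1 + 1/p] unless [e = 2], where [h (p ^ 2) = 1 + 1/p^2].

    Since [h (2 ^ a) < 2] and [h (3 ^ b) < 3/2], the product [h (2 ^ a) h (3 ^ b)]
    falls short of 3 by a relative deficit [d2 + d3], roughly, and this bounds the
    primes of [M] from below.  If [d2] dominates, the primes of
    [2 ^ k - 1], a factor of [sigma (2 ^ a)], are too small, unless [2 ^ k - 1 = q] is
    prime and [q ^ 2] divides [N] exactly; then 5 divides [2 ^ (k + 1) + 1] or
    [q ^ 2 + 1].  If [d3] dominates, the same happens with [(3 ^ k - 1) / 2].  But 5
    is nearly excluded: it forces [5 ^ 2], [13 ^ 2] and [17 ^ 2] to be exact divisors, and
    [sigma (13 ^ 2) = 170] and [sigma (17 ^ 2) = 290] already use up both factors 5.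

    The case [a = 4] resists this, but there [N] has at most three prime divisors
    larger than 3, and sizes, orders modulo small primes and the exact power of 2
    dividing [sigma N] leave only 2160. *)

Set Implicit Arguments.
Unset Strict Implicit.
Unset Printing Implicit Defensive.

(** * Multiplicativity of [sigma_biunitary] and its values at prime powers *)

(** The recurring obstacle is an exact square [p ^ 2]. Only there does [h (p ^ e)] drop below
    [1 + 1/p], so size arguments fail; in return [sigma (p ^ 2) = p ^ 2 + 1] brings in new primes:
    13 from 5, 5 from 7, 5 and 17 from 13, 5 and 29 from 17, 61 from 11. For [a, b >= 5] the product
    [h (2 ^ a) h (3 ^ b)] is at least [h (2 ^ 6) h (3 ^ 6) = (119/64)(1066/729)], about 2.72; a
    factor 6/5 or 8/7 already pushes this past 3. The case [a = 4] escapes because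
    [sigma (2 ^ 4) = 27] supplies no new prime, and [h (2 ^ 4) h (3 ^ b) < (27/16)(3/2) = 81/32]
    leaves a large gap that small primes may fill, as 5 does in 2160. *)

Lemma logn_unitary p u n : 0 < n -> unitary_divisor u n -> p %| u ->
  logn p u = logn p n.
Proof.
move=> n_gt0 /andP[dvd_un co_u] p_dvd_u.
have u_gt0 : 0 < u by apply: dvdn_gt0 dvd_un.
have co_p : coprime p (n %/ u) by apply: coprime_dvdl p_dvd_u co_u.
by rewrite -[in RHS](divnK dvd_un) logn_Gauss.
Qed.

Lemma unitary_pfactor p n : 0 < n -> prime p -> unitary_divisor (p ^ logn p n) n.
Proof.
move=> n_gt0 p_pr; apply/andP; split; first exact: pfactor_dvdnn.
have [m co_pm {2}->] := pfactor_coprime p_pr n_gt0.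
by rewrite mulnK ?expn_gt0 ?prime_gt0 // coprimeXl.
Qed.

(** A prime of a common unitary divisor [u > 1] has the same exponent in [u], [d] and [n %/ d];
    conversely a prime with equal positive exponents in [d] and [n %/ d] yields a common unitary
    prime power. *)
Lemma biunitary_logn d n : 0 < n ->
  biunitary_divisor d n =
  (d %| n) && all (fun p => (logn p d).*2 != logn p n) (primes n).
Proof.
move=> n_gt0; rewrite /biunitary_divisor; case dvd_dn: (d %| n) => //=.
have d_gt0 : 0 < d by apply: dvdn_gt0 dvd_dn.
have q_gt0 : 0 < n %/ d by rewrite divn_gt0 //; apply: dvdn_leq.
have lognE p : logn p n = logn p d + logn p (n %/ d).
  by rewrite -lognM // mulnC divnK.
have gcd1_ge1 : 0 < gcd1 d (n %/ d).
  rewrite /gcd1 (big_rem 1) ?divisor1 //= /unitary_divisor !dvd1n !coprime1n /=.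
  by rewrite leq_max.
rewrite eqn_leq gcd1_ge1 andbT; apply/idP/allP => [le1 p|H].
  rewrite -logn_gt0 => lp_gt0; apply/negP=> /eqP E.
  have p_pr : prime p by move: lp_gt0; rewrite logn_gt0 mem_primes => /and3P[].
  have Eqd : logn p d = logn p (n %/ d) by have := lognE p; lia.
  have: p ^ logn p d <= gcd1 d (n %/ d).
    apply: (@leq_bigmax_seq _ _ _ id).
      by rewrite -dvdn_divisors // pfactor_dvdnn.
    by rewrite unitary_pfactor //= Eqd unitary_pfactor.
  have := ltn_expl (logn p d) (prime_gt1 p_pr).
  lia.
apply/bigmax_leqP_seq => u _ /andP[u1 u2]; rewrite leqNgt; apply/negP => u_gt1.
have p_pr := pdiv_prime u_gt1; have p_dvd := pdiv_dvd u.
have dvd_ud : u %| d by case/andP: u1.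
have := H (pdiv u); rewrite mem_primes p_pr n_gt0 (dvdn_trans p_dvd (dvdn_trans dvd_ud dvd_dn)).
move=> /(_ isT); rewrite lognE -(logn_unitary d_gt0 u1) // -(logn_unitary q_gt0 u2) //.
by rewrite -addnn eqxx.
Qed.

(** The inverse of the product map sends [d] to [(gcdn d m, gcdn d n)]. *)
Lemma perm_divisorsM m n : 0 < m -> 0 < n -> coprime m n ->
  perm_eq (divisors (m * n)) [seq x * y | x <- divisors m, y <- divisors n].
Proof.
move=> m_gt0 n_gt0 co_mn; apply: uniq_perm; first exact: divisors_uniq.
  apply: allpairs_uniq; try exact: divisors_uniq.
  move=> [x y] [x' y'] /allpairsP[[u v] [+ + /= [-> ->]]].
  rewrite -!dvdn_divisors //= => dx dy /allpairsP[[u' v'] [+ + /= [-> ->]]].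
  rewrite -!dvdn_divisors //= => dx' dy' E.
  have gcdE z t : z %| m -> t %| n -> gcdn m (z * t) = z.
    move=> dz dt; rewrite Gauss_gcdl; first exact/gcdn_idPr.
    by apply: coprime_dvdr dt co_mn.
  have gcdE' z t : z %| m -> t %| n -> gcdn n (z * t) = t.
    move=> dz dt; rewrite Gauss_gcdr; first exact/gcdn_idPr.
    by rewrite coprime_sym; apply: coprime_dvdl dz co_mn.
  congr (_, _); first by rewrite -(gcdE u v) // E gcdE.
  by rewrite -(gcdE' u v) // E gcdE'.
move=> d; apply/idP/allpairsP => [|[[x y] /= []]].
  rewrite -dvdn_divisors ?muln_gt0 ?m_gt0 // => dd.
  exists (gcdn d m, gcdn d n); rewrite /= -!dvdn_divisors ?dvdn_gcdr //; split=> //.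
  apply/eqP; rewrite eqn_dvd; apply/andP; split.
    by rewrite muln_gcdl dvdn_gcd dvdn_mulr //= muln_gcdr dvdn_gcd dd dvdn_mull.
  rewrite Gauss_dvd ?dvdn_gcdl //.
  by apply: coprime_dvdl (dvdn_gcdr _ _) _; apply: coprime_dvdr (dvdn_gcdr _ _) _.
rewrite -!dvdn_divisors ?muln_gt0 ?m_gt0 // => dx dy ->; exact: dvdn_mul.
Qed.

Lemma biunitary_divisorM m n x y : 0 < m -> 0 < n -> coprime m n ->
  x %| m -> y %| n ->
  biunitary_divisor (x * y) (m * n) = biunitary_divisor x m && biunitary_divisor y n.
Proof.
move=> m_gt0 n_gt0 co_mn dx dy.
rewrite !biunitary_logn ?muln_gt0 ?m_gt0 // dvdn_mul // dx dy /=.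
have x_gt0 := dvdn_gt0 m_gt0 dx; have y_gt0 := dvdn_gt0 n_gt0 dy.
have Hm p : p \in primes m -> logn p n = 0 /\ logn p y = 0.
  rewrite mem_primes => /and3P[_ _ pm].
  have co : coprime p n by apply: coprime_dvdl pm co_mn.
  by split; apply: logn_coprime => //; apply: coprime_dvdr dy co.
have Hn p : p \in primes n -> logn p m = 0 /\ logn p x = 0.
  rewrite mem_primes => /and3P[_ _ pn].
  have co : coprime p m by rewrite coprime_sym; apply: coprime_dvdr pn co_mn.
  by split; apply: logn_coprime => //; apply: coprime_dvdr dx co.
apply/allP/andP => [H|[/allP H1 /allP H2] p].
  split; apply/allP => p pp; have := H p; rewrite primesM // pp ?orbT => /(_ isT);
    rewrite !lognM //.
  - by have [-> ->] := Hm p pp; rewrite !addn0.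
  - by have [-> ->] := Hn p pp; rewrite !add0n.
rewrite primesM // => /orP[] pp; rewrite !lognM //.
- by have [-> ->] := Hm p pp; rewrite !addn0; apply: H1.
- by have [-> ->] := Hn p pp; rewrite !add0n; apply: H2.
Qed.

Lemma sigma_biunitaryM m n : 0 < m -> 0 < n -> coprime m n ->
  sigma_biunitary (m * n) = sigma_biunitary m * sigma_biunitary n.
Proof.
move=> m_gt0 n_gt0 co_mn; rewrite /sigma_biunitary big_mkcond.
rewrite (perm_big _ (perm_divisorsM m_gt0 n_gt0 co_mn)) big_allpairs_dep /=.
rewrite [in RHS]big_mkcond big_distrl /=; apply: eq_big_seq => x.
rewrite -dvdn_divisors // => dx; rewrite [in RHS]big_mkcond big_distrr /=.
apply: eq_big_seq => y; rewrite -dvdn_divisors // => dy.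
rewrite biunitary_divisorM //.
by case: (biunitary_divisor x m); case: (biunitary_divisor y n); rewrite //= ?muln0.
Qed.

Lemma divisors_pfactor p e : prime p ->
  perm_eq (divisors (p ^ e)) [seq p ^ i | i <- iota 0 e.+1].
Proof.
move=> p_pr; have p_gt1 := prime_gt1 p_pr.
apply: uniq_perm; first exact: divisors_uniq.
  by rewrite map_inj_uniq ?iota_uniq // => i j /eqP; rewrite eqn_exp2l // => /eqP.
move=> d; rewrite -dvdn_divisors ?expn_gt0 ?prime_gt0 //.
apply/dvdn_pfactor/mapP => // [[i le_ie ->]|[i]].
  by exists i; rewrite // mem_iota.
by rewrite mem_iota => le_ie ->; exists i.
Qed.

Definition repunit p m := \sum_(i < m) p ^ i.

(** For [e = 0] the filter would drop the only term, although 1 is a biunitary divisor of 1. *)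
Lemma sigma_pfactor_sum p e : prime p -> 0 < e ->
  sigma_biunitary (p ^ e) = \sum_(0 <= i < e.+1 | i.*2 != e) p ^ i.
Proof.
move=> p_pr e_gt0; rewrite /sigma_biunitary big_mkcond.
rewrite (perm_big _ (divisors_pfactor e p_pr)) big_map -{1}[e.+1]subn0 -/(index_iota 0 e.+1).
rewrite [in RHS]big_mkcond; apply: eq_big_nat => i /andP[_ lt_ie].
rewrite biunitary_logn ?expn_gt0 ?prime_gt0 // dvdn_exp2l //=.
by rewrite primesX // primes_prime //= !pfactorK // andbT.
Qed.

Lemma repunitD p m n : repunit p (m + n) = repunit p m + p ^ m * repunit p n.
Proof.
rewrite /repunit big_split_ord /= big_distrr /=; congr (_ + _).
by apply: eq_bigr => i _; rewrite expnD.
Qed.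

Lemma sigma_even p m : prime p -> 0 < m ->
  sigma_biunitary (p ^ m.*2) = repunit p m * (p ^ m.+1).+1.
Proof.
move=> p_pr m_gt0; rewrite sigma_pfactor_sum ?double_gt0 //.
(* Cut the range at the missing exponent [m]: the block above it is [p ^ m.+1] times the block
   below. *)
have -> : m.*2.+1 = m + (1 + m) by lia.
rewrite (@big_cat_nat _ _ _ m) //=; last by lia.
rewrite big_nat_cond (eq_bigl (fun i => 0 <= i < m)); last by move=> i /=; lia.
rewrite -big_nat big_mkord -/(repunit p m).
rewrite big_ltn_cond; last by lia.
rewrite eqxx /= big_nat_cond (eq_bigl (fun i => m.+1 <= i < m + (1 + m))); last by move=> i /=; lia.
rewrite -big_nat -{1}[m.+1]add0n big_addn.
have -> : m + (1 + m) - m.+1 = m by lia.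
rewrite big_mkord mulnS; congr (_ + _).
by rewrite /repunit big_distrl /=; apply: eq_bigr => i _; rewrite expnD.
Qed.

Lemma sigma_odd p m : prime p ->
  sigma_biunitary (p ^ m.*2.+1) = repunit p m.+1 * (p ^ m.+1).+1.
Proof.
move=> p_pr; rewrite sigma_pfactor_sum //.
rewrite big_nat_cond (eq_bigl (fun i => 0 <= i < m.*2.+2)); last by move=> i /=; lia.
rewrite -big_nat big_mkord -/(repunit p _).
have -> : m.*2.+2 = m.+1 + m.+1 by lia.
by rewrite repunitD mulnS [X in _ = _ + X]mulnC.
Qed.

(** * Bounds for [sigma_biunitary (p ^ e)] *)

Lemma sigma1 : sigma_biunitary 1 = 1.
Proof. by rewrite /sigma_biunitary big_mkcond big_seq1 /biunitary_divisor /gcd1 big_mkcond big_seq1. Qed.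

Lemma leq_sigma n : 0 < n -> n <= sigma_biunitary n.
Proof.
move=> n_gt0; rewrite /sigma_biunitary (big_rem n) ?divisors_id //=.
suff -> : biunitary_divisor n n by apply: leq_addr.
rewrite biunitary_logn // dvdnn; apply/allP => p; rewrite -logn_gt0; lia.
Qed.

Lemma repunitE p m : 0 < p -> p.-1 * repunit p m + 1 = p ^ m.
Proof. by move=> p_gt0; rewrite -predn_exp addn1 prednK ?expn_gt0 ?p_gt0. Qed.

Lemma repunit_gt0 p m : 0 < m -> 0 < repunit p m.
Proof. by case: m => // m _; rewrite /repunit big_ord_recl. Qed.

Lemma repunitS p m : repunit p m.+1 = 1 + p * repunit p m.
Proof. by rewrite -add1n repunitD /repunit big_ord1 expn1. Qed.

Lemma repunit_even p m : p.+1 %| repunit p m.*2.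
Proof.
elim: m => [|m IH]; first by rewrite /repunit big_ord0.
rewrite doubleS !repunitS; have -> r : 1 + p * (1 + p * r) = p.+1 + p * p * r by nia.
by rewrite dvdn_add // dvdn_mull.
Qed.

Lemma odd_repunit p m : odd p -> odd (repunit p m) = odd m.
Proof.
by move=> op; elim: m => [|m IH]; [rewrite /repunit big_ord0 | rewrite repunitS add1n /= oddM op IH].
Qed.

Lemma double_exp p m : p ^ m.*2 = p ^ m * p ^ m.
Proof. by rewrite -addnn expnD. Qed.

Lemma repunit_ge2 p m : 1 < m -> p.+1 <= repunit p m.
Proof.
by case: m => [|[|m]] // _; rewrite repunitS; have := @repunit_gt0 p m.+1 isT; nia.
Qed.

Lemma repunit_ge3 p m : 2 < m -> p * p + p + 1 <= repunit p m.
Proof.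
by case: m => [|[|[|m]]] // _; rewrite repunitS; have := @repunit_ge2 p m.+2 isT; nia.
Qed.

Lemma even_or_odd n : (exists m, n = m.*2) \/ (exists m, n = m.*2.+1).
Proof.
have := odd_double_half n; case: (odd n) => /= <-; [right|left]; by exists n./2.
Qed.

Lemma sigma_prime_sqr p : prime p -> sigma_biunitary (p ^ 2) = p ^ 2 + 1.
Proof.
move=> p_pr; rewrite (@sigma_even p 1) //.
by rewrite /repunit big_ord1 expn0 mul1n addn1.
Qed.

(** [h (p ^ e)] is the sum of [p ^ -j] over [j <= e] with [j] different from [e / 2]. The term [1/p]
    is lost only for [e = 2], and for [e >= 3] a further term remains. *)
Lemma sigma_gt_ge3 p e : prime p -> 2 < e ->
  p.+1 * p ^ e < p * sigma_biunitary (p ^ e).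
Proof.
move=> p_pr e_gt2; have p_gt1 := prime_gt1 p_pr.
case: (even_or_odd e) => [[m Em]|[m Em]]; subst e.
  have m_gt1 : 1 < m by lia.
  have RE := @repunitE p m (ltnW p_gt1); have R2 := repunit_ge2 p m_gt1.
  rewrite sigma_even //; last by lia.
  rewrite double_exp expnS; move: RE R2; set P := p ^ m; set R := repunit _ _ => RE R2.
  (* From [(p - 1) * R = P - 1] one gets [p * R = P + r]; then [P <= p * r] supplies the extra
     [P * P]. *)
  have [r Er] : exists r, R = r + 1 by exists R.-1; lia.
  have h1 : P <= p * r by nia.
  have h2 : P * P <= p * r * P by rewrite leq_mul2r h1 orbT.
  have h3 : p * R = P + r by nia.
  have -> : p * (R * (p * P).+1) = (P + r) * (p * P).+1 by rewrite -h3; lia.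
  clear -h2 RE; lia.
case: m e_gt2 => [|m] // _.
have m_gt1 : 1 < m.+2 by lia.
have RE := @repunitE p m.+2 (ltnW p_gt1); have R2 := repunit_ge2 p m_gt1.
rewrite sigma_odd //.
have EE : p * p ^ m.+1.*2.+1 = p ^ m.+2 * p ^ m.+2.
  by rewrite -expnS -expnD; congr (_ ^ _); lia.
move: RE R2 EE; set P := p ^ m.+2; set R := repunit _ _; set E := p ^ _ => RE R2 EE.
have [r Er] : exists r, R = r + 1 by exists R.-1; lia.
have h1 : P <= p * r by nia.
have h2 : P * P <= p * r * P by rewrite leq_mul2r h1 orbT.
have h3 : p * R = P + r by nia.
have h4 : E <= r * P by rewrite -(leq_pmul2l (ltnW p_gt1)); lia.
have -> : p * (R * P.+1) = (P + r) * P.+1 by rewrite -h3; lia.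
clear -h4 RE EE; lia.
Qed.

Lemma sigma_ge_n2 p e : prime p -> 0 < e -> e != 2 ->
  p.+1 * p ^ e <= p * sigma_biunitary (p ^ e).
Proof.
move=> p_pr e_gt0 e_n2; have [e3|e3] := leqP 3 e; first exact: ltnW (sigma_gt_ge3 p_pr e3).
have -> : e = 1 by lia.
by rewrite (@sigma_odd p 0) // /repunit big_ord1 !expn0 expn1 mul1n mulnC.
Qed.

(** The term [p ^ -2] is lost only for [e = 4], so the first three terms survive here. *)
Lemma sigma_ge5 p e : prime p -> 4 < e ->
  (p * p + p + 1) * p ^ e <= p * p * sigma_biunitary (p ^ e).
Proof.
move=> p_pr e_gt4; have p_gt1 := prime_gt1 p_pr.
case: (even_or_odd e) => [[m Em]|[m Em]]; subst e.
  have m_gt2 : 2 < m by lia.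
  have RE := @repunitE p m (ltnW p_gt1); have R2 := repunit_ge3 p m_gt2.
  rewrite sigma_even //; last by lia.
  rewrite double_exp expnS; move: RE R2; set P := p ^ m; set R := repunit _ _ => RE R2.
  have [r Er] : exists r, R = r + p + 1 by exists (R - p - 1); lia.
  have h1 : P <= p * r by nia.
  have h2 : P * P <= p * r * P by rewrite leq_mul2r h1 orbT.
  have h3 : p * p * R = p * P + P + r by nia.
  have -> : p * p * (R * (p * P).+1) = (p * P + P + r) * (p * P).+1 by rewrite -h3; lia.
  clear -h2; lia.
case: m e_gt4 => [|m] // e_gt4.
have m_gt2 : 2 < m.+2 by lia.
have RE := @repunitE p m.+2 (ltnW p_gt1); have R2 := repunit_ge3 p m_gt2.
rewrite sigma_odd //.
have EE : p * p ^ m.+1.*2.+1 = p ^ m.+2 * p ^ m.+2.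
  by rewrite -expnS -expnD; congr (_ ^ _); lia.
move: RE R2 EE; set P := p ^ m.+2; set R := repunit _ _; set E := p ^ _ => RE R2 EE.
have [r Er] : exists r, R = r + p + 1 by exists (R - p - 1); lia.
have h1 : P <= p * r by nia.
have h2 : P * P <= p * r * P by rewrite leq_mul2r h1 orbT.
have h3 : p * p * R = p * P + P + r by nia.
have h4 : E <= r * P by rewrite -(leq_pmul2l (ltnW p_gt1)); lia.
have -> : p * p * (R * P.+1) = (p * P + P + r) * P.+1 by rewrite -h3; lia.
have h5 : p * p * E = p * P * P by rewrite -mulnA EE mulnA.
clear -h4 h5 EE; lia.
Qed.

Lemma sigma_ge p e : prime p -> 0 < e ->
  (p ^ 2 + 1) * p ^ e <= p ^ 2 * sigma_biunitary (p ^ e).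
Proof.
move=> p_pr e_gt0; have [->|/eqP e_n2] := e =P 2; first by rewrite sigma_prime_sqr // mulnC.
have := sigma_ge_n2 p_pr e_gt0 e_n2; have := prime_gt1 p_pr; rewrite -mulnn.
set E := p ^ e; set s := sigma_biunitary _ => p_gt1 H.
have : p * (p.+1 * E) <= p * (p * s) by rewrite leq_mul2l H orbT.
nia.
Qed.

(** Restoring the missing term and continuing the geometric series gives [p / (p - 1)]. *)
Lemma sigma_le p e : prime p ->
  p.-1 * sigma_biunitary (p ^ e) <= p * p ^ e.
Proof.
move=> p_pr; have p_gt1 := prime_gt1 p_pr.
case: (even_or_odd e) => [[[|m] ->]|[m ->]].
- by rewrite sigma1; lia.
- rewrite sigma_even // double_exp expnS.
  have := @repunitE p m.+1 (ltnW p_gt1); move: (p ^ m.+1) (repunit _ _) => P R RE.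
  case: P RE => [|x] RE; first by lia.
have E : p.-1 * R = x by lia.
rewrite mulnA E; nia.
rewrite sigma_odd //.
have -> : p * p ^ m.*2.+1 = p ^ m.+1 * p ^ m.+1.
  by rewrite -expnS -expnD; congr (_ ^ _); lia.
have := @repunitE p m.+1 (ltnW p_gt1); move: (p ^ m.+1) (repunit _ _) => P R RE.
case: P RE => [|x] RE; first by lia.
have E : p.-1 * R = x by lia.
rewrite mulnA E; nia.
Qed.

Lemma dvdn_expS_odd p m : odd m -> p.+1 %| (p ^ m).+1.
Proof.
case: (even_or_odd m) => [[n ->]|[n ->] _]; first by rewrite odd_double.
elim: n => [|n IH]; first by rewrite expn1.
case: p IH => [|p] IH; first by rewrite exp0n.
have -> : p.+1 ^ n.+1.*2.+1 = p.+1 * p.+1 * p.+1 ^ n.*2.+1 by rewrite doubleS !expnS; lia.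
rewrite -(@dvdn_addl (p * p.+2)) ?dvdn_mull //.
have -> x : (p.+1 * p.+1 * x).+1 + p * p.+2 = p.+1 * p.+1 * x.+1 by nia.
by rewrite dvdn_mull.
Qed.

(** [p + 1] divides a repunit with an even number of terms, and [p ^ n + 1] for odd [n]. One of the
    two factors of [sigma (p ^ e)] is of this kind, except when [e = 2m] with [m] odd. *)
Lemma sigma_dvd_or p e : prime p -> 0 < e ->
  p.+1 %| sigma_biunitary (p ^ e) \/ exists2 m, odd m & e = m.*2.
Proof.
move=> p_pr e_gt0; case: (even_or_odd e) => [[m Em]|[m Em]]; subst e.
  case om: (odd m); first by right; exists m.
  left; rewrite sigma_even //; last by lia.
  by apply: dvdn_mulr; rewrite -(odd_double_half m) om repunit_even.
left; rewrite sigma_odd //; case om: (odd m.+1).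
  by apply: dvdn_mull; apply: dvdn_expS_odd.
by apply: dvdn_mulr; rewrite -(odd_double_half m.+1) om repunit_even.
Qed.

Lemma sigma_dvd2 p e : prime p -> odd p -> 0 < e -> 2 %| sigma_biunitary (p ^ e).
Proof.
move=> p_pr p_odd e_gt0; case: (sigma_dvd_or p_pr e_gt0) => [|[m om Em]].
  by apply: dvdn_trans; rewrite dvdn2 /= p_odd.
subst e; rewrite sigma_even //; last by case: m om {e_gt0}.
by apply: dvdn_mull; rewrite dvdn2 /= oddX p_odd orbT.
Qed.

(** * Splitting off finitely many prime powers *)

(** [K] is the part of [N] prime to [s]; later either [sigma K >= K] suffices, or [s] exhausts the
    primes of [N] and [K = 1]. *)
Lemma sigma_split N s : 0 < N -> uniq s -> all prime s ->
  exists K, [/\ 0 < K, N = (\prod_(p <- s) p ^ logn p N) * K,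
    sigma_biunitary N =
      (\prod_(p <- s) sigma_biunitary (p ^ logn p N)) * sigma_biunitary K &
    forall q, prime q -> q %| K -> (q %| N) && (q \notin s)].
Proof.
move=> N_gt0; elim: s => [_ _|p s IH].
  by exists N; rewrite !big_nil !mul1n; split=> // q _ ->.
rewrite !cons_uniq /= => /andP[p_notin s_uniq] /andP[p_pr s_pr].
have [K [K_gt0 NE sE HK]] := IH s_uniq s_pr.
have co_p : coprime p (\prod_(q <- s) q ^ logn q N).
  rewrite big_seq; apply: (big_ind (coprime p)) => [|x y cx cy|q qs].
  - exact: coprimen1.
  - by rewrite coprimeMr cx.
  rewrite coprimeXr // prime_coprime // dvdn_prime2 //; last exact: (allP s_pr).
  by apply: contraNneq p_notin => ->.
have EpK : logn p N = logn p K by rewrite [LHS](congr1 (logn p) NE) logn_Gauss.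
have [K' co_pK' KE] := pfactor_coprime p_pr K_gt0.
have K'_gt0 : 0 < K' by move: K_gt0; rewrite KE muln_gt0 => /andP[].
have co_K' : coprime K' (p ^ logn p K) by rewrite coprime_sym coprimeXl.
exists K'; rewrite !big_cons EpK; split=> //.
- by apply: etrans NE _; rewrite [X in _ * X = _]KE mulnA mulnC mulnA.
- rewrite sE [X in _ * sigma_biunitary X = _]KE.
  by rewrite (sigma_biunitaryM K'_gt0 (pfactor_gt0 _ _) co_K') mulnA mulnC mulnA.
move=> q q_pr q_dvd; have /HK : q %| K by rewrite KE dvdn_mulr.
case/(_ q_pr)/andP=> -> q_s; rewrite inE negb_or q_s andbT /=.
by apply: contraTneq co_pK' => <-; rewrite prime_coprime // q_dvd.
Qed.

Definition triperfect N := 0 < N /\ sigma_biunitary N = 3 * N.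

(* [x / y] is a lower (resp. upper) bound for [h (p ^ logn p N)]. *)
Definition ratio_ge N p x y :=
  prime p /\ x * p ^ logn p N <= y * sigma_biunitary (p ^ logn p N).
Definition ratio_le N p x y :=
  prime p /\ y * sigma_biunitary (p ^ logn p N) <= x * p ^ logn p N.
Definition sigma_dvd N p d := prime p /\ d %| sigma_biunitary (p ^ logn p N).

(** A recursive conjunction, so that a list of estimates is proved by a nested [conj] ending in
    [I]. *)
Fixpoint all_triple (R : nat -> nat -> nat -> Prop) (l : seq (nat * nat * nat)) :=
  if l is (p, x, y) :: l' then R p x y /\ all_triple R l' else True.
Fixpoint all_pair (R : nat -> nat -> Prop) (l : seq (nat * nat)) :=
  if l is (p, x) :: l' then R p x /\ all_pair R l' else True.

Definition nums (l : seq (nat * nat * nat)) := foldr (fun t z => t.1.2 * z) 1 l.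
Definition dens (l : seq (nat * nat * nat)) := foldr (fun t z => t.2 * z) 1 l.
Definition bases (l : seq (nat * nat * nat)) := [seq t.1.1 | t <- l].

Lemma all_triple_prime N l : all_triple (ratio_ge N) l \/ all_triple (ratio_le N) l -> all prime (bases l).
Proof.
elim: l => [|[[p x] y] l IH] //= [] [[p_pr _] H]; rewrite p_pr /=; apply: IH; by [left|right].
Qed.

Lemma triperfect_ge N l : triperfect N -> uniq (bases l) -> all_triple (ratio_ge N) l ->
  nums l <= 3 * dens l.
Proof.
move=> [N_gt0 sN] l_uniq H.
have [K [K_gt0 NE sE _]] := sigma_split N_gt0 l_uniq (all_triple_prime (or_introl H)).
have : nums l * (\prod_(p <- bases l) p ^ logn p N) <=
       dens l * (\prod_(p <- bases l) sigma_biunitary (p ^ logn p N)).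
  elim: l {l_uniq NE sE} H => [|[[p x] y] l IH] /= ; first by rewrite !big_nil.
  move=> [[_ H1] H2]; rewrite !big_cons mulnACA [leqRHS]mulnACA.
  exact: leq_mul H1 (IH H2).
rewrite sN in sE; move: NE sE; set P := \prod_(p <- _) _; set Q := \prod_(p <- _) _ => NE sE H1.
have H2 := leq_mul H1 (leq_sigma K_gt0).
rewrite -!mulnA -sE -NE in H2.
by rewrite -(leq_pmul2r N_gt0); lia.
Qed.

Lemma triperfect_le N l : triperfect N -> uniq (bases l) -> all_triple (ratio_le N) l ->
  (forall q, prime q -> q %| N -> q \in bases l) -> 3 * dens l <= nums l.
Proof.
move=> [N_gt0 sN] l_uniq H Hq.
have [K [K_gt0 NE sE HK]] := sigma_split N_gt0 l_uniq (all_triple_prime (or_intror H)).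
have K1 : K = 1.
  case: (ltngtP K 1) => //; first by lia.
  move=> K_gt1; have := HK _ (pdiv_prime K_gt1) (pdiv_dvd K) => /andP[d].
  by rewrite Hq ?pdiv_prime.
have : dens l * (\prod_(p <- bases l) sigma_biunitary (p ^ logn p N)) <=
       nums l * (\prod_(p <- bases l) p ^ logn p N).
  elim: l {l_uniq NE sE Hq HK} H => [|[[p x] y] l IH] /= ; first by rewrite !big_nil.
  move=> [[_ H1] H2]; rewrite !big_cons mulnACA [leqRHS]mulnACA.
  exact: leq_mul H1 (IH H2).
rewrite K1 sigma1 !muln1 in NE sE; rewrite -sE -NE sN => H1.
by rewrite -(leq_pmul2r N_gt0); lia.
Qed.

Lemma all_pair_prime N l : all_pair (sigma_dvd N) l -> all prime (unzip1 l).
Proof. by elim: l => [|[p x] l IH] //= [[-> _] /IH]. Qed.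

Lemma triperfect_dvd N l : triperfect N -> uniq (unzip1 l) -> all_pair (sigma_dvd N) l ->
  foldr (fun t z => t.2 * z) 1 l %| 3 * N.
Proof.
move=> [N_gt0 sN] l_uniq H.
have [K [K_gt0 NE sE _]] := sigma_split N_gt0 l_uniq (all_pair_prime H).
rewrite -sN sE dvdn_mulr //.
elim: l {l_uniq NE sE} H => [|[p x] l IH] //= [[_ H1] H2].
by rewrite big_cons dvdn_mul // IH.
Qed.

Section Ratios.
Context (N : nat) (TN : triperfect N).

Lemma logn_triperfect_gt0 p : prime p -> p %| N -> 0 < logn p N.
Proof. by case: TN => N_gt0 _ p_pr pN; rewrite logn_gt0 mem_primes p_pr N_gt0. Qed.

Lemma ratio_ge_n2 p : p %| N -> logn p N != 2 -> prime p -> ratio_ge N p p.+1 p.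
Proof. by move=> pN n2 p_pr; split=> //; apply: sigma_ge_n2 => //; apply: logn_triperfect_gt0. Qed.

Lemma ratio_ge_any p : p %| N -> prime p -> ratio_ge N p (p ^ 2 + 1) (p ^ 2).
Proof. by move=> pN p_pr; split=> //; apply: sigma_ge => //; apply: logn_triperfect_gt0. Qed.

Lemma ratio_ge_5 p : prime p -> 4 < logn p N -> ratio_ge N p (p * p + p + 1) (p * p).
Proof. by move=> p_pr pN; split=> //; apply: sigma_ge5. Qed.

(** [n / (n - 1)] decreases with [n], so a lower bound on a prime bounds its ratio from above. *)
Lemma ratio_le_any n p : prime p -> n <= p -> ratio_le N p n n.-1.
Proof.
move=> p_pr le_np; split=> //; have := sigma_le (logn p N) p_pr.
have := prime_gt1 p_pr; have := leq_sigma (pfactor_gt0 p N).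
move: (p ^ _) (sigma_biunitary _) => P s Hs p_gt1 H.
case: n le_np => [|n] //= le_np.
have [d Ed] : exists d, p = d + n.+1 by exists (p - n.+1); lia.
subst p; nia.
Qed.

Lemma ratio_le_2 p : prime p -> logn p N = 2 -> ratio_le N p (p ^ 2 + 1) (p ^ 2).
Proof. by move=> p_pr E; split=> //; rewrite E sigma_prime_sqr // mulnC. Qed.

Lemma sigma_dvd_2 p : prime p -> logn p N = 2 -> sigma_dvd N p (p ^ 2 + 1).
Proof. by move=> p_pr E; split=> //; rewrite E sigma_prime_sqr. Qed.

Lemma sigma_dvd_odd p : prime p -> 2 < p -> p %| N -> sigma_dvd N p 2.
Proof.
move=> p_pr p_gt2 pN; split=> //; apply: sigma_dvd2 => //; last exact: logn_triperfect_gt0.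
by case: (even_prime p_pr) => // E; rewrite E in p_gt2.
Qed.

Lemma sigma_dvd_S p : prime p -> p %| N ->
  sigma_dvd N p p.+1 \/ exists2 m, odd m & logn p N = m.*2.
Proof.
move=> p_pr pN; case: (sigma_dvd_or p_pr (logn_triperfect_gt0 p_pr pN)) => H; [left|right] => //.
Qed.

Lemma sigma_dvd_trans p d d' : d' %| d -> sigma_dvd N p d -> sigma_dvd N p d'.
Proof. by move=> dd [p_pr H]; split=> //; apply: dvdn_trans H. Qed.

Lemma prime_dvd_triperfect p q : prime q -> q != 3 -> sigma_dvd N p q -> q %| N.
Proof.
move=> q_pr q_n3 H; have := @triperfect_dvd N [:: (p, q)] TN isT (conj H I).
by rewrite /= muln1 Euclid_dvdM // dvdn_prime2 // (negPf q_n3).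
Qed.

(** The tool for counting factors [q] in [sigma N = 3 * N], applied to 2, 5 and 29 against a known
    exponent of [q] in [N]. *)
Lemma prime_exp_dvd_triperfect q e l : prime q -> q != 3 -> uniq (unzip1 l) ->
  all_pair (sigma_dvd N) l -> q ^ e %| foldr (fun t z => t.2 * z) 1 l -> e <= logn q N.
Proof.
move=> q_pr q_n3 l_uniq H D; have := dvdn_trans D (triperfect_dvd TN l_uniq H).
rewrite Gauss_dvdr; first by rewrite pfactor_dvdn //; case: TN.
by rewrite coprimeXl // prime_coprime // dvdn_prime2.
Qed.
End Ratios.

(** * Powers modulo small numbers, and the primes 2 and 3 *)

(** Reducing after each multiplication keeps numbers small, so that a whole period can be
    evaluated. *)
Definition powmod p d k := iter k (fun x => (x * p) %% d) (1 %% d).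

Lemma powmodE p d k : p ^ k %% d = powmod p d k.
Proof. by elim: k => //= k <-; rewrite expnSr modnMml. Qed.

(** Decides by evaluation over one period [t] any relation between the exponent modulo [t] and the
    power modulo [d]. *)
Lemma expn_modP p d t (P : nat -> nat -> bool) k : 0 < t -> powmod p d t = 1 %% d ->
  all (fun r => P r (powmod p d r)) (iota 0 t) -> P (k %% t) (p ^ k %% d).
Proof.
move=> t_gt0 Ht /allP H.
have -> : p ^ k %% d = powmod p d (k %% t).
  rewrite -powmodE {1}(divn_eq k t) expnD [_ %/ _ * _]mulnC expnM -modnMml -modnXm.
  by rewrite (powmodE p d t) Ht modnXm exp1n modnMml mul1n.
by apply: H; rewrite mem_iota ltn_mod.
Qed.

Lemma dvd_repunit_mod p m d : 0 < p -> d %| repunit p m -> p ^ m %% d = 1 %% d.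
Proof.
by move=> p_gt0 /dvdnP[c E]; rewrite -(repunitE m p_gt0) E mulnA modnMDl.
Qed.

Lemma mod_dvd_repunit p m d : 0 < p -> coprime d p.-1 -> p ^ m %% d = 1 %% d ->
  d %| repunit p m.
Proof.
move=> p_gt0 co E; rewrite -(Gauss_dvdr _ co).
have := repunitE m p_gt0; set x := _ * _ => Ex.
have := eqn_mod_dvd d (leq_addl x 1); rewrite addnK => <-.
by rewrite Ex E.
Qed.

Lemma dvd_expS_mod x d : 0 < d -> d %| x.+1 -> x %% d = d.-1.
Proof.
move=> d_gt0 /dvdnP[[|c] E] //.
have -> : x = c * d + d.-1 by lia.
by rewrite modnMDl modn_small // prednK.
Qed.

Lemma mod_dvd_expS x d : 0 < d -> x %% d = d.-1 -> d %| x.+1.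
Proof. by move=> d_gt0 E; rewrite {1}(divn_eq x d) E -addnS prednK // dvdn_addr ?dvdn_mull. Qed.

Lemma repunit2 m : (repunit 2 m).+1 = 2 ^ m.
Proof. by rewrite -(@repunitE 2) // mul1n addn1. Qed.

Lemma repunit3 m : (2 * repunit 3 m).+1 = 3 ^ m.
Proof. by rewrite -(@repunitE 3) // addn1. Qed.

Lemma exp_ge p n m : 0 < p -> n <= m -> p ^ n <= p ^ m.
Proof. by move=> p_gt0 le_nm; rewrite leq_pexp2l. Qed.

Section TwoThree.
Context (N : nat).
Local Notation a := (logn 2 N).
Local Notation b := (logn 3 N).

Lemma sigma2_even k : 0 < k -> sigma_biunitary (2 ^ k.*2) = (2 ^ k).-1 * (2 * 2 ^ k).+1.
Proof. by move=> k_gt0; rewrite sigma_even // expnS -(repunit2 k). Qed.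

Lemma sigma2_odd k : sigma_biunitary (2 ^ k.*2.+1) = (2 ^ k.+1).-1 * (2 ^ k.+1).+1.
Proof. by rewrite sigma_odd // -(repunit2 k.+1). Qed.

(** [119/64 = h (2 ^ 6)] is the minimum over [a >= 5]. *)
Lemma ratio2_ge5 : 4 < a -> ratio_ge N 2 119 64.
Proof.
move=> a5; split=> //; case: (even_or_odd a) => [[k Ek]|[k Ek]]; rewrite Ek in a5 *.
  rewrite sigma2_even ?double_exp; last by lia.
  have := @exp_ge 2 3 k isT; have -> : 2 ^ 3 = 8 by [].
  move=> /(_ ltac:(lia)); move: (2 ^ k) => P P8.
  have [x ->] : exists x, P = x + 8 by exists (P - 8); lia.
  have -> : (x + 8).-1 = x + 7 by lia.
  nia.
rewrite sigma2_odd; have := @exp_ge 2 3 k.+1 isT; have -> : 2 ^ 3 = 8 by [].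
move=> /(_ ltac:(lia)).
have : 2 * 2 ^ k.*2.+1 = 2 ^ k.+1 * 2 ^ k.+1 by rewrite -expnS -expnD; congr (_ ^ _); lia.
move: (2 ^ k.+1) (2 ^ k.*2.+1) => P E EP P8.
have -> : P.-1 * P.+1 = P * P - 1 by nia.
nia.
Qed.

(** Without [a = 6] the minimum is [495/256 = h (2 ^ 8)]. *)
Lemma ratio2_ge7 : 4 < a -> a != 6 -> ratio_ge N 2 495 256.
Proof.
move=> a5 a6; split=> //; case: (even_or_odd a) => [[k Ek]|[k Ek]]; rewrite Ek in a5 a6 *.
  rewrite sigma2_even ?double_exp; last by lia.
  have := @exp_ge 2 4 k isT; have -> : 2 ^ 4 = 16 by [].
  move=> /(_ ltac:(lia)); move: (2 ^ k) => P P8.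
  have [x ->] : exists x, P = x + 16 by exists (P - 16); lia.
  have -> : (x + 16).-1 = x + 15 by lia.
  nia.
rewrite sigma2_odd; have := @exp_ge 2 3 k.+1 isT; have -> : 2 ^ 3 = 8 by [].
move=> /(_ ltac:(lia)).
have : 2 * 2 ^ k.*2.+1 = 2 ^ k.+1 * 2 ^ k.+1 by rewrite -expnS -expnD; congr (_ ^ _); lia.
move: (2 ^ k.+1) (2 ^ k.*2.+1) => P E EP P8.
have -> : P.-1 * P.+1 = P * P - 1 by nia.
nia.
Qed.

Lemma sigma3_even k : 0 < k ->
  2 * sigma_biunitary (3 ^ k.*2) = (3 ^ k).-1 * (3 * 3 ^ k).+1.
Proof. by move=> k_gt0; rewrite sigma_even // mulnA expnS -(repunit3 k). Qed.

Lemma sigma3_odd k :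
  2 * sigma_biunitary (3 ^ k.*2.+1) = (3 ^ k.+1).-1 * (3 ^ k.+1).+1.
Proof. by rewrite sigma_odd // mulnA -(repunit3 k.+1). Qed.

(** [364/243 = h (3 ^ 5)]. *)
Lemma ratio3_odd : 4 < b -> odd b -> ratio_ge N 3 364 243.
Proof.
move=> b5 ob; split=> //; case: (even_or_odd b) => [[k Ek]|[k Ek]]; rewrite Ek in b5 ob *.
  by rewrite odd_double in ob.
have := sigma3_odd k; have := @exp_ge 3 3 k.+1 isT; have -> : 3 ^ 3 = 27 by [].
move=> /(_ ltac:(lia)).
have : 3 * 3 ^ k.*2.+1 = 3 ^ k.+1 * 3 ^ k.+1 by rewrite -expnS -expnD; congr (_ ^ _); lia.
move: (3 ^ k.+1) (3 ^ k.*2.+1) (sigma_biunitary _) => P E s EP P8.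
have -> : P.-1 * P.+1 = P * P - 1 by nia.
nia.
Qed.

(** [1066/729 = h (3 ^ 6)]. *)
Lemma ratio3_even k : 2 < k -> b = k.*2 -> ratio_ge N 3 1066 729.
Proof.
move=> k3 Ek; split=> //; rewrite Ek.
have := @sigma3_even k ltac:(lia); rewrite double_exp.
have := @exp_ge 3 3 k isT; have -> : 3 ^ 3 = 27 by [].
move=> /(_ ltac:(lia)); move: (3 ^ k) (sigma_biunitary _) => P s P27.
have [x ->] : exists x, P = x + 27 by exists (P - 27); lia.
have -> : (x + 27).-1 = x + 26 by lia.
nia.
Qed.

(** A short fraction just below [h (3 ^ 10)]; in the next lemma, just below [h (3 ^ 14)]. *)
Lemma ratio3_even5 k : 4 < k -> b = k.*2 -> ratio_ge N 3 1077 720.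
Proof.
move=> k3 Ek; split=> //; rewrite Ek.
have := @sigma3_even k ltac:(lia); rewrite double_exp.
have := @exp_ge 3 5 k isT; have -> : 3 ^ 5 = 243 by [].
move=> /(_ ltac:(lia)); move: (3 ^ k) (sigma_biunitary _) => P s P27.
have [x ->] : exists x, P = x + 243 by exists (P - 243); lia.
have -> : (x + 243).-1 = x + 242 by lia.
nia.
Qed.

Lemma ratio3_even7 k : 6 < k -> b = k.*2 -> ratio_ge N 3 2999 2000.
Proof.
move=> k3 Ek; split=> //; rewrite Ek.
have := @sigma3_even k ltac:(lia); rewrite double_exp.
have := @exp_ge 3 7 k isT; have -> : 3 ^ 7 = 2187 by vm_compute.
move=> /(_ ltac:(lia)); move: (3 ^ k) (sigma_biunitary _) => P s P27.
have [x ->] : exists x, P = x + 2187 by exists (P - 2187); lia.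
have -> : (x + 2187).-1 = x + 2186 by lia.
nia.
Qed.

Lemma ratio3_ge5 : 4 < b -> ratio_ge N 3 1066 729.
Proof.
move=> b5; case: (even_or_odd b) => [[k Ek]|[k Ek]].
  by apply: (ratio3_even _ Ek); lia.
have [] := ratio3_odd b5; first by rewrite Ek /= odd_double.
move=> p3 H; split=> //; move: (3 ^ _) (sigma_biunitary _) H => x y; lia.
Qed.

Lemma ratio_exact p e x y : prime p -> logn p N = e -> sigma_biunitary (p ^ e) = x ->
  p ^ e = y -> ratio_ge N p x y /\ ratio_le N p x y.
Proof.
move=> p_pr E1 E2 E3; rewrite /ratio_ge /ratio_le E1 E2 E3.
by split; split=> //; rewrite mulnC.
Qed.

End TwoThree.

Lemma sigma_2_1 : sigma_biunitary (2 ^ 1) = 3.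
Proof. by rewrite (@sigma2_odd 0). Qed.
Lemma sigma_2_2 : sigma_biunitary (2 ^ 2) = 5.
Proof. by rewrite (@sigma2_even 1). Qed.
Lemma sigma_2_3 : sigma_biunitary (2 ^ 3) = 15.
Proof. by rewrite (@sigma2_odd 1). Qed.
Lemma sigma_2_4 : sigma_biunitary (2 ^ 4) = 27.
Proof. by rewrite (@sigma2_even 2). Qed.
Lemma sigma_2_6 : sigma_biunitary (2 ^ 6) = 119.
Proof. by rewrite (@sigma2_even 3). Qed.
Lemma sigma_3_3 : sigma_biunitary (3 ^ 3) = 40.
Proof. by apply/eqP; rewrite -(eqn_pmul2l (isT : 0 < 2)) (@sigma3_odd 1). Qed.
Lemma sigma_3_4 : sigma_biunitary (3 ^ 4) = 112.
Proof. by apply/eqP; rewrite -(eqn_pmul2l (isT : 0 < 2)) (@sigma3_even 2). Qed.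
Lemma sigma_3_6 : sigma_biunitary (3 ^ 6) = 1066.
Proof. by apply/eqP; rewrite -(eqn_pmul2l (isT : 0 < 2)) (@sigma3_even 3). Qed.

(** * Small exponents of 2 and 3 *)

Section Small.
Context (N : nat) (TN : triperfect N).

(* The hypothesis on [x2 / y2] and [x3 / y3] says [h (2 ^ a) h (3 ^ b) >= h (2 ^ 6) h (3 ^ 6)]. *)
Lemma dvd5_logn x2 y2 x3 y3 : ratio_ge N 2 x2 y2 -> ratio_ge N 3 x3 y3 ->
  119 * 1066 * (y2 * y3) <= 64 * 729 * (x2 * x3) -> 0 < y2 * y3 -> 5 %| N ->
  [/\ logn 5 N = 2, logn 13 N = 2 & logn 17 N = 2].
Proof.
move=> R2 R3 H H0 d5.
have E5 : logn 5 N = 2.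
  apply/eqP; apply/negP => /negP E.
  have := triperfect_ge TN (l := [:: (2,x2,y2); (3,x3,y3); (5,6,5)]) isT
    (conj R2 (conj R3 (conj (ratio_ge_n2 TN d5 E isT) I))).
  rewrite /nums /dens /=; lia.
have R5 := ratio_ge_any TN d5 isT.
(* The chain is [5 ^ 2 + 1 = 2 * 13] and [13 ^ 2 + 1 = 2 * 5 * 17]; each new prime must have
   exponent 2, since a factor [1 + 1/p] would push the product past 3. *)
have d13 : 13 %| N.
  apply: (prime_dvd_triperfect TN (p := 5)) => //.
  by apply: sigma_dvd_trans (sigma_dvd_2 _ E5).
have E13 : logn 13 N = 2.
  apply/eqP; apply/negP => /negP E.
  have := triperfect_ge TN (l := [:: (2,x2,y2); (3,x3,y3); (5,26,25); (13,14,13)]) isT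
    (conj R2 (conj R3 (conj R5 (conj (ratio_ge_n2 TN d13 E isT) I)))).
  rewrite /nums /dens /=; lia.
have d17 : 17 %| N.
  apply: (prime_dvd_triperfect TN (p := 13)) => //.
  by apply: sigma_dvd_trans (sigma_dvd_2 _ E13).
split=> //.
apply/eqP; apply/negP => /negP E.
have := triperfect_ge TN
  (l := [:: (2,x2,y2); (3,x3,y3); (5,26,25); (13,170,169); (17,18,17)]) isT
  (conj R2 (conj R3 (conj R5 (conj (ratio_ge_any TN d13 isT)
     (conj (ratio_ge_n2 TN d17 E isT) I))))).
rewrite /nums /dens /=; lia.
Qed.

Context (b3 : 2 < logn 3 N).
Local Notation a := (logn 2 N).
Local Notation b := (logn 3 N).

Lemma dvd3N : 3 %| N.
Proof. by have := ltnW (ltnW b3); rewrite logn_gt0 mem_primes => /and3P[]. Qed.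

Lemma sigma_dvd_3 : sigma_dvd N 3 2.
Proof. exact: sigma_dvd_odd dvd3N. Qed.

Lemma prime_cases q : prime q -> q %| N -> [\/ q = 2, q = 3, q = 5 | 5 < q].
Proof.
move=> q_pr qN; case: (ltngtP q 5) => [|h|->]; last 2 first.
- by constructor 4.
- by constructor 3.
case: q q_pr qN => [|[|[|[|[|q]]]]] // _ _ _; [by constructor 1|by constructor 2].
Qed.

Lemma two_adic e l : uniq (unzip1 l) -> all_pair (sigma_dvd N) l ->
  2 ^ e %| foldr (fun t z => t.2 * z) 1 l -> e <= a.
Proof. exact: prime_exp_dvd_triperfect. Qed.

(** With at most [a] odd primes, [h N] is at most [(3/2)(3/2)] for [a = 1] and [(5/4)(3/2)(5/4)] for
    [a = 2], both below 3. *)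
Lemma logn2_gt2 : 2 < a.
Proof.
have sd3 := sigma_dvd_3.
have [a0|[a1|[a2|//]]] : a = 0 \/ a = 1 \/ a = 2 \/ 2 < a by lia.
- by have := @two_adic 1 [:: (3,2)] isT (conj sd3 I) isT; rewrite a0.
- have [_ R2] := @ratio_exact N 2 1 3 2 isT a1 sigma_2_1 (erefl _).
  have := triperfect_le TN (l := [:: (2,3,2); (3,3,2)]) isT
    (conj R2 (conj (@ratio_le_any N 3 3 isT isT) I)).
  rewrite /nums /dens /=; suff H : forall q, prime q -> q %| N -> q \in [:: 2; 3].
    by move=> /(_ H).
  move=> q q_pr qN; rewrite !inE; apply: contraT; rewrite negb_or => /andP[n2 n3].
  have := @two_adic 2 [:: (3,2); (q,2)] _ (conj sd3 (conj (@sigma_dvd_odd _ TN q q_pr _ qN) I)) isT.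
  rewrite a1 /= inE eq_sym n3 => /(_ isT) H.
  by have := prime_gt1 q_pr; case: (ltngtP q 2) H => //; lia.
have d5 : 5 %| N.
  by apply: (prime_dvd_triperfect TN (p := 2)) => //; split=> //; rewrite a2 sigma_2_2.
have [_ R2] := @ratio_exact N 2 2 5 4 isT a2 sigma_2_2 (erefl _).
have := triperfect_le TN (l := [:: (2,5,4); (3,3,2); (5,5,4)]) isT
  (conj R2 (conj (@ratio_le_any N 3 3 isT isT) (conj (@ratio_le_any N 5 5 isT isT) I))).
rewrite /nums /dens /=; suff H : forall q, prime q -> q %| N -> q \in [:: 2; 3; 5].
  by move=> /(_ H).
move=> q q_pr qN; case: (prime_cases q_pr qN) => [->|->|->|q5] //.
have := @two_adic 3 [:: (3,2); (5,2); (q,2)] _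
  (conj sd3 (conj (@sigma_dvd_odd _ TN 5 isT isT d5) (conj (@sigma_dvd_odd _ TN q q_pr _ qN) I))) isT.
rewrite a2 /= !inE => H; exfalso; suff : 3 <= 2 by []. 
apply: H; lia.
Qed.

(** [sigma (2 ^ 3) = 15] brings in 5, and then [2 ^ 4] divides [sigma N]: from 40 and 5 if [b = 3],
    from 112 if [b = 4], otherwise from 3, 5, 13 and 17. *)
Lemma logn2_neq3 : a != 3.
Proof.
apply/negP => /eqP a3.
have d5 : 5 %| N.
  by apply: (prime_dvd_triperfect TN (p := 2)) => //; split=> //; rewrite a3 sigma_2_3.
have sd5 := @sigma_dvd_odd _ TN 5 isT isT d5.
have sd3 := sigma_dvd_3.
have [E|[E|b5]] : b = 3 \/ b = 4 \/ 4 < b by lia.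
- have sd : sigma_dvd N 3 8 by split=> //; rewrite E sigma_3_3.
  by have := @two_adic 4 [:: (3,8); (5,2)] isT (conj sd (conj sd5 I)) isT; rewrite a3.
- have sd : sigma_dvd N 3 16 by split=> //; rewrite E sigma_3_4.
  by have := @two_adic 4 [:: (3,16)] isT (conj sd I) isT; rewrite a3.
have [R2 _] := @ratio_exact N 2 3 15 8 isT a3 sigma_2_3 (erefl _).
have [E5 E13 E17] := dvd5_logn R2 (ratio3_ge5 b5) ltac:(lia) isT d5.
have := @two_adic 4 [:: (3,2); (5,2); (13,10); (17,10)] isT.
rewrite a3 => H; suff : 4 <= 3 by [].
apply: H => //; split=> //; split=> //; split; last split=> //.
- exact: sigma_dvd_trans (sigma_dvd_2 _ E13).
- exact: sigma_dvd_trans (sigma_dvd_2 _ E17).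
Qed.

(** [sigma (3 ^ 3) = 40] contributes a third factor 5 besides those of 170 and 290. *)
Lemma logn3_neq3 : 4 < a -> b = 3 -> False.
Proof.
move=> a5 E.
have sd : sigma_dvd N 3 5 by split=> //; rewrite E sigma_3_3.
have [R3 _] := @ratio_exact N 3 3 40 27 isT E sigma_3_3 (erefl _).
have d5 : 5 %| N by apply: (prime_dvd_triperfect TN (p := 3)).
have [E5 E13 E17] := dvd5_logn (ratio2_ge5 a5) R3 ltac:(lia) isT d5.
have := @prime_exp_dvd_triperfect _ TN 5 3 [:: (3,5); (13,5); (17,5)] isT isT isT.
rewrite E5 => H; suff : 3 <= 2 by [].
apply: H => //; split=> //; split; last split=> //.
- exact: sigma_dvd_trans (sigma_dvd_2 _ E13).
- exact: sigma_dvd_trans (sigma_dvd_2 _ E17).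
Qed.

(** [h (3 ^ 4) = 112/81] is below [h (3 ^ 6)], so [dvd5_logn] may fail; the prime 7 of 112 takes
    over. An exact [7 ^ 2] gives [50 = 2 * 5 ^ 2], hence an exact [5 ^ 2], and no room for an exact
    [13 ^ 2] or [17 ^ 2]; other exponents make the product too large. *)
Lemma logn3_neq4 : 4 < a -> b = 4 -> False.
Proof.
move=> a5 E.
have sd : sigma_dvd N 3 7 by split=> //; rewrite E sigma_3_4.
have [R3 _] := @ratio_exact N 3 4 112 81 isT E sigma_3_4 (erefl _).
have d7 : 7 %| N by apply: (prime_dvd_triperfect TN (p := 3)).
have sqr7 x2 y2 : ratio_ge N 2 x2 y2 -> 119 * y2 <= 64 * x2 -> 0 < y2 -> logn 7 N = 2 ->
  [/\ sigma_dvd N 7 25, logn 5 N = 2 & 13 %| N].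
  move=> R2 H H0 E7.
  have sd7 : sigma_dvd N 7 25 by apply: sigma_dvd_trans (sigma_dvd_2 _ E7).
  have d5 : 5 %| N.
    by apply: (prime_dvd_triperfect TN (p := 7)) => //; apply: sigma_dvd_trans sd7.
  have E5 : logn 5 N = 2.
    apply/eqP; apply/negP => /negP E5.
    have := triperfect_ge TN (l := [:: (2,x2,y2); (3,112,81); (7,50,49); (5,6,5)]) isT
      (conj R2 (conj R3 (conj (ratio_ge_any TN d7 isT) (conj (ratio_ge_n2 TN d5 E5 isT) I)))).
    rewrite /nums /dens /=; lia.
  split=> //; apply: (prime_dvd_triperfect TN (p := 5)) => //.
  by apply: sigma_dvd_trans (sigma_dvd_2 _ E5).
have no53 p : logn 5 N = 2 -> sigma_dvd N 7 25 -> p != 7 -> sigma_dvd N p 5 -> False.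
  move=> E5 sd7 pn7 sdp.
  have := @prime_exp_dvd_triperfect _ TN 5 3 [:: (7,25); (p,5)] isT isT.
  rewrite E5 => H; suff : 3 <= 2 by [].
  by apply: H => //=; rewrite inE eq_sym pn7.
have [a6|/eqP an6] := a =P 6.
  have [R2 _] := @ratio_exact N 2 6 119 64 isT a6 sigma_2_6 (erefl _).
  have d17 : 17 %| N.
    by apply: (prime_dvd_triperfect TN (p := 2)) => //; split=> //; rewrite a6 sigma_2_6.
  have [E7|/eqP En7] := logn 7 N =P 2.
    have [sd7 E5 d13] := sqr7 _ _ R2 isT isT E7.
    have [E13|/eqP En13] := logn 13 N =P 2.
      by apply: (no53 13) => //; apply: sigma_dvd_trans (sigma_dvd_2 _ E13).
    have [E17|/eqP En17] := logn 17 N =P 2.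
      by apply: (no53 17) => //; apply: sigma_dvd_trans (sigma_dvd_2 _ E17).
    have d5 : 5 %| N.
      by apply: (prime_dvd_triperfect TN (p := 7)) => //; apply: sigma_dvd_trans sd7.
    have := triperfect_ge TN
      (l := [:: (2,119,64); (3,112,81); (7,50,49); (5,26,25); (13,14,13); (17,18,17)]) isT
      (conj R2 (conj R3 (conj (ratio_ge_any TN d7 isT) (conj (ratio_ge_any TN d5 isT)
      (conj (ratio_ge_n2 TN d13 En13 isT) (conj (ratio_ge_n2 TN d17 En17 isT) I)))))).
    rewrite /nums /dens /=; lia.
  have R7 := ratio_ge_n2 TN d7 En7 isT.
  have [E17|/eqP En17] := logn 17 N =P 2.
    have d5 : 5 %| N.
      apply: (prime_dvd_triperfect TN (p := 17)) => //.
      by apply: sigma_dvd_trans (sigma_dvd_2 _ E17).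
    have := triperfect_ge TN (l := [:: (2,119,64); (3,112,81); (7,8,7); (5,26,25)]) isT
      (conj R2 (conj R3 (conj R7 (conj (ratio_ge_any TN d5 isT) I)))).
    rewrite /nums /dens /=; lia.
  have := triperfect_ge TN (l := [:: (2,119,64); (3,112,81); (7,8,7); (17,18,17)]) isT
    (conj R2 (conj R3 (conj R7 (conj (ratio_ge_n2 TN d17 En17 isT) I)))).
  rewrite /nums /dens /=; lia.
have R2 := ratio2_ge7 a5 an6.
have [E7|/eqP En7] := logn 7 N =P 2; last first.
  have := triperfect_ge TN (l := [:: (2,495,256); (3,112,81); (7,8,7)]) isT
    (conj R2 (conj R3 (conj (ratio_ge_n2 TN d7 En7 isT) I))).
  rewrite /nums /dens /=; lia.
have [sd7 E5 d13] := sqr7 _ _ R2 ltac:(lia) isT E7.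
have d5 : 5 %| N.
  by apply: (prime_dvd_triperfect TN (p := 7)) => //; apply: sigma_dvd_trans sd7.
have [E13|/eqP En13] := logn 13 N =P 2.
  by apply: (no53 13) => //; apply: sigma_dvd_trans (sigma_dvd_2 _ E13).
have := triperfect_ge TN
  (l := [:: (2,495,256); (3,112,81); (7,50,49); (5,26,25); (13,14,13)]) isT
  (conj R2 (conj R3 (conj (ratio_ge_any TN d7 isT) (conj (ratio_ge_any TN d5 isT)
  (conj (ratio_ge_n2 TN d13 En13 isT) I))))).
rewrite /nums /dens /=; lia.
Qed.
End Small.

(** * Both exponents at least 5 *)

Lemma odd_repunit2 m : 0 < m -> odd (repunit 2 m).
Proof. by move=> m_gt0; have := repunit2 m; case: m m_gt0 => // m _; rewrite expnS; lia. Qed.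

Lemma repunit2_mod3 m : odd m -> ~~ (3 %| repunit 2 m).
Proof.
move=> om; apply/negP => /(dvd_repunit_mod (isT : 0 < 2)).
have := @expn_modP 2 3 2 (fun r x => (r == 1) ==> (x == 2)) m isT (erefl _) isT.
by rewrite modn2 om /= => /eqP ->.
Qed.

Lemma odd_repunit3 m : odd m -> odd (repunit 3 m).
Proof. by rewrite odd_repunit. Qed.

Lemma repunit3_mod3 m : 0 < m -> ~~ (3 %| repunit 3 m).
Proof. by case: m => // m _; have := repunit3 m.+1; rewrite expnS; lia. Qed.

Lemma prime_gt3 p r : prime p -> p %| r -> odd r -> ~~ (3 %| r) -> 3 < p.
Proof.
move=> p_pr pr or r3; have := prime_gt1 p_pr.
case: p p_pr pr => [|[|[|[|p]]]] //=; first by rewrite dvdn2 or.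
by move=> _ H; rewrite H in r3.
Qed.

Lemma pdiv_small r : 1 < r -> ~~ prime r -> pdiv r ^ 2 <= r.
Proof.
move=> r_gt1; rewrite leqNgt; apply: contra => H; apply: ltn_pdiv2_prime => //; lia.
Qed.

Section Large.
Context (N : nat) (TN : triperfect N).
Local Notation a := (logn 2 N).
Local Notation b := (logn 3 N).
Context (a5 : 4 < a) (b5 : 4 < b).

Lemma sigma_not_dvd5 p : p != 13 -> p != 17 -> sigma_dvd N p 5 -> False.
Proof.
move=> p13 p17 sd.
have d5 : 5 %| N by apply: (prime_dvd_triperfect TN (p := p)).
have [E5 E13 E17] := dvd5_logn TN (ratio2_ge5 a5) (ratio3_ge5 b5) ltac:(lia) isT d5.
have := @prime_exp_dvd_triperfect _ TN 5 3 [:: (p,5); (13,5); (17,5)] isT isT.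
rewrite E5 => H; suff : 3 <= 2 by [].
apply: H => //=; first by rewrite !inE negb_or p13 p17.
do !split=> //; first by rewrite E13 sigma_prime_sqr.
by rewrite E17 sigma_prime_sqr.
Qed.

(** [7 ^ 2 + 1 = 50] is a multiple of 5, and every other exponent gives the excessive factor 8/7. *)
Lemma not_dvd7 : 7 %| N -> False.
Proof.
move=> d7; have [E7|/eqP E7] := logn 7 N =P 2.
  by apply: (@sigma_not_dvd5 7) => //; apply: sigma_dvd_trans (sigma_dvd_2 _ E7).
have := triperfect_ge TN (l := [:: (2,119,64); (3,1066,729); (7,8,7)]) isT
  (conj (ratio2_ge5 a5) (conj (ratio3_ge5 b5) (conj (ratio_ge_n2 TN d7 E7 isT) I))).
rewrite /nums /dens /=; lia.
Qed.

(** Needed separately because [(3 ^ 3 - 1) / 2 = 13] is an exception of [sigma_not_dvd5]. From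
    [sigma (3 ^ 6) = 2 * 13 * 41] an exact [13 ^ 2] follows, then 5, 17 and 29. *)
Lemma logn3_neq6 : b = 6 -> False.
Proof.
move=> b6; have R3 := ratio3_ge5 b5.
have a6 : a != 6.
  apply/negP => /eqP a6; apply: not_dvd7; apply: (prime_dvd_triperfect TN (p := 2)) => //.
  by split=> //; rewrite a6 sigma_2_6.
have R2 := ratio2_ge7 a5 a6.
have d13 : 13 %| N.
  by apply: (prime_dvd_triperfect TN (p := 3)) => //; split=> //; rewrite b6 sigma_3_6.
have d41 : 41 %| N.
  by apply: (prime_dvd_triperfect TN (p := 3)) => //; split=> //; rewrite b6 sigma_3_6.
have [E13|/eqP E13] := logn 13 N =P 2; last first.
  have := triperfect_ge TN (l := [:: (2,495,256); (3,1066,729); (13,14,13)]) isT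
    (conj R2 (conj R3 (conj (ratio_ge_n2 TN d13 E13 isT) I))).
  rewrite /nums /dens /=; lia.
have d5 : 5 %| N.
  apply: (prime_dvd_triperfect TN (p := 13)) => //.
  by apply: sigma_dvd_trans (sigma_dvd_2 _ E13).
have [E5 _ E17] := dvd5_logn TN (ratio2_ge5 a5) R3 ltac:(lia) isT d5.
have d17 : 17 %| N.
  apply: (prime_dvd_triperfect TN (p := 13)) => //.
  by apply: sigma_dvd_trans (sigma_dvd_2 _ E13).
have sd17 : sigma_dvd N 17 29 by apply: sigma_dvd_trans (sigma_dvd_2 _ E17).
have d29 : 29 %| N by apply: (prime_dvd_triperfect TN (p := 17)).
(* Next to these five prime powers a factor [1 + 1/p] with [p <= 41] exceeds 3, so 29 and 41 must
   have exponent 2. *)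
have RR p : p %| N -> logn p N != 2 -> prime p -> p \notin [:: 2; 3; 5; 13; 17] -> 41 < p.
  move=> pN p2 p_pr pn.
  have U : uniq [:: 2; 3; 5; 13; 17; p] by move: pn; rewrite /= !inE; lia.
  have := triperfect_ge TN
    (l := [:: (2,495,256); (3,1066,729); (5,26,25); (13,170,169); (17,290,289); (p,p.+1,p)]) U
    (conj R2 (conj R3 (conj (ratio_ge_any TN d5 isT) (conj (ratio_ge_any TN d13 isT)
    (conj (ratio_ge_any TN d17 isT) (conj (ratio_ge_n2 TN pN p2 p_pr) I)))))).
  by rewrite /nums /dens /=; lia.
have [E29|/eqP E29] := logn 29 N =P 2; last first.
  by have := RR 29 d29 E29 isT isT.
have [E41|/eqP E41] := logn 41 N =P 2; last first.
  by have := RR 41 d41 E41 isT isT.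
(* [17 ^ 2 + 1 = 2 * 5 * 29] and [41 ^ 2 + 1 = 2 * 29 ^ 2] together put [29 ^ 3] into [sigma N]. *)
have := @prime_exp_dvd_triperfect _ TN 29 3 [:: (17,29); (41,29 * 29)] isT isT isT.
rewrite E29 => H; suff : 3 <= 2 by [].
apply: H => //; do 2!split=> //.
by apply: (sigma_dvd_trans _ (sigma_dvd_2 _ E41)).
Qed.

(* [n2 / d2] and [n3 / d3] are the relative deficits [1 - h (2 ^ a) / 2] and
   [1 - 2 h (3 ^ b) / 3]; the unequal split by the ratio 3/4 leaves room in both cases. *)
Lemma deficit2 n2 d2 n3 d3 p x y :
  ratio_ge N 2 (2 * (d2 - n2)) d2 -> ratio_ge N 3 (3 * (d3 - n3)) (2 * d3) ->
  n2 <= d2 -> n3 <= d3 -> 0 < d3 -> 4 * (n3 * d2) <= 3 * (n2 * d3) ->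
  3 < p -> ratio_ge N p x y -> 4 * (d2 * x) <= 4 * (d2 * y) + 7 * (n2 * x).
Proof.
move=> R2 R3 l2 l3 d3_gt0 H p3 Rp.
have := triperfect_ge TN
  (l := [:: (2, 2 * (d2 - n2), d2); (3, 3 * (d3 - n3), 2 * d3); (p, x, y)]) _
  (conj R2 (conj R3 (conj Rp I))).
rewrite /nums /dens /= !inE !muln1 => /(_ ltac:(lia)).
have [u Eu] : exists u, d2 = u + n2 by exists (d2 - n2); lia.
have [v Ev] : exists v, d3 = v + n3 by exists (d3 - n3); lia.
have -> : d2 - n2 = u by lia.
have -> : d3 - n3 = v by lia.
move=> K.
have K1 : u * v * x <= d2 * d3 * y by lia.
(* This is [(1 - n2/d2)(1 - n3/d3) >= 1 - n2/d2 - n3/d3], cleared of denominators. *)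
have K2 : d2 * d3 * x <= u * v * x + n2 * d3 * x + n3 * d2 * x.
  rewrite -!mulnDl leq_mul2r; apply/orP; right; rewrite Eu Ev; nia.
have K3 : 4 * (n3 * d2) * x <= 3 * (n2 * d3) * x by rewrite leq_mul2r H orbT.
rewrite -(leq_pmul2r d3_gt0); lia.
Qed.

Lemma deficit3 n2 d2 n3 d3 p x y :
  ratio_ge N 2 (2 * (d2 - n2)) d2 -> ratio_ge N 3 (3 * (d3 - n3)) (2 * d3) ->
  n2 <= d2 -> n3 <= d3 -> 0 < d2 -> 3 * (n2 * d3) <= 4 * (n3 * d2) ->
  3 < p -> ratio_ge N p x y -> 3 * (d3 * x) <= 3 * (d3 * y) + 7 * (n3 * x).
Proof.
move=> R2 R3 l2 l3 d2_gt0 H p3 Rp.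
have := triperfect_ge TN
  (l := [:: (2, 2 * (d2 - n2), d2); (3, 3 * (d3 - n3), 2 * d3); (p, x, y)]) _
  (conj R2 (conj R3 (conj Rp I))).
rewrite /nums /dens /= !inE !muln1 => /(_ ltac:(lia)).
have [u Eu] : exists u, d2 = u + n2 by exists (d2 - n2); lia.
have [v Ev] : exists v, d3 = v + n3 by exists (d3 - n3); lia.
have -> : d2 - n2 = u by lia.
have -> : d3 - n3 = v by lia.
move=> K.
have K1 : u * v * x <= d2 * d3 * y by lia.
have K2 : d2 * d3 * x <= u * v * x + n2 * d3 * x + n3 * d2 * x.
  rewrite -!mulnDl leq_mul2r; apply/orP; right; rewrite Eu Ev; nia.
have K3 : 3 * (n2 * d3) * x <= 4 * (n3 * d2) * x by rewrite leq_mul2r H orbT.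
rewrite -(leq_pmul2r d2_gt0); lia.
Qed.

(** The second hypothesis is the conclusion of [deficit2] for the deficit
    [(2 ^ k + 1) / (2 * 4 ^ k)]. *)
Lemma even2_absurd k : a = k.*2 ->
  (forall p x y, 3 < p -> ratio_ge N p x y ->
     4 * (2 * (2 ^ k * 2 ^ k) * x) <= 4 * (2 * (2 ^ k * 2 ^ k) * y) + 7 * ((2 ^ k).+1 * x)) ->
  False.
Proof.
move=> Ek H; have k3 : 2 < k by lia.
have P8 : 8 <= 2 ^ k := @exp_ge 2 3 k isT k3.
(* With [P = 2 ^ k], [H] gives [y + 1 >= 8 P^2 / (7 (P + 1))], more than [P] since [P >= 8].
   Splitting the deficits equally would give only [P^2 / (P + 1)], which does not exclude
   [y = 2 ^ k - 1]. *)
have small p y : 3 < p -> ratio_ge N p y.+1 y -> y < 2 ^ k -> False.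
  move=> p3 /(H _ _ _ p3) K yP.
  have : (2 ^ k).+1 * y.+1 <= (2 ^ k).+1 * 2 ^ k by rewrite leq_mul2l yP orbT.
  move: (2 ^ k) P8 K => P P8 K K2.
  have : 8 * P <= P * P by rewrite leq_mul2r P8 orbT.
  nia.
have sdR d : d %| repunit 2 k -> sigma_dvd N 2 d.
  by move=> dd; split=> //; rewrite Ek sigma_even ?dvdn_mulr //; lia.
have RE := repunit2 k.
case: (even_or_odd k) => [[i Ei]|[i Ei]]; subst k.
  case oi: (odd i); last first.
    apply: (@sigma_not_dvd5 2) => //; apply: sdR; apply: mod_dvd_repunit => //.
    have := @expn_modP 2 5 4 (fun r x => (r == 0) ==> (x == 1)) i.*2 isT (erefl _) isT.
    by have -> /= : i.*2 %% 4 == 0 by [lia]; move/eqP.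
  (* [2 ^ i - 1] divides [2 ^ k - 1], and the squares of its primes stay below [2 ^ k = 4 ^ i]. *)
  have i3 : 2 < i by lia.
  have Ri := repunit2 i; have := @exp_ge 2 3 i isT i3; rewrite -Ri => R7.
  set r := repunit 2 i in Ri R7; have r_gt1 : 1 < r by lia.
  have p_pr := pdiv_prime r_gt1; have p_dvd := pdiv_dvd r.
  have p3 : 3 < pdiv r.
    by apply: (prime_gt3 p_pr p_dvd); [apply: odd_repunit2; lia | apply: repunit2_mod3].
  have pN : pdiv r %| N.
    apply: (prime_dvd_triperfect TN (p := 2)) => //; first by lia.
    by apply: sdR; rewrite -addnn repunitD -mulSn dvdn_mull.
  apply: (small _ (pdiv r ^ 2) p3); first by have := ratio_ge_any TN pN p_pr; rewrite addn1.
  rewrite double_exp -Ri -mulnn; have : pdiv r <= r by apply: dvdn_leq => //; lia.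
  by move=> ?; nia.
have ok : odd i.*2.+1 by rewrite /= odd_double.
set k := i.*2.+1 in Ek H k3 P8 small sdR RE ok *; set r := repunit 2 k in RE.
have r_gt1 : 1 < r by lia.
have p3 p : prime p -> p %| r -> 3 < p.
  by move=> p_pr pr; apply: (prime_gt3 p_pr pr); [apply: odd_repunit2 | apply: repunit2_mod3].
have pN p : prime p -> p %| r -> p %| N.
  move=> p_pr pr; apply: (prime_dvd_triperfect TN (p := 2)) => //; last exact: sdR.
  by have := p3 _ p_pr pr; lia.
have [r_pr|r_npr] := boolP (prime r); last first.
  have p_pr := pdiv_prime r_gt1; have p_dvd := pdiv_dvd r.
  apply: (small (pdiv r) (pdiv r ^ 2)); first exact: p3.
    by have := ratio_ge_any TN (pN _ p_pr p_dvd) p_pr; rewrite addn1.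
  by have := pdiv_small r_gt1 r_npr; lia.
have [Er|/eqP Er] := logn r N =P 2; last first.
  apply: (small r r); [exact: p3|exact: ratio_ge_n2 (pN _ r_pr (dvdnn _)) Er r_pr|by lia].
have := @expn_modP 2 5 4 (fun r x => ((r == 1) ==> (x == 2)) && ((r == 3) ==> (x == 3))) k isT (erefl _) isT.
have [k1|k1] : k %% 4 = 1 \/ k %% 4 = 3 by lia.
  rewrite k1 /= andbT => /eqP E.
  apply: (@sigma_not_dvd5 2) => //; split=> //; rewrite Ek sigma_even //; apply: dvdn_mull.
  by apply: mod_dvd_expS => //; rewrite expnS -modnMmr E.
rewrite k1 /= => /eqP E.
(* Hence [r] is 7 modulo 8, so it is neither 13 nor 17. *)
have E8 : 2 ^ k = 8 * 2 ^ (k - 3) by rewrite -(expnD 2 3) subnKC.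
apply: (@sigma_not_dvd5 r); try by lia.
split=> //; rewrite Er sigma_prime_sqr //.
have [c Ec] : exists c, r = 5 * c + 2 by exists (r %/ 5); lia.
rewrite Ec -mulnn; apply/dvdnP; exists (5 * c * c + 4 * c + 1); lia.
Qed.

(** With [n = k + 1] the deficit is [4 ^ -n], and [H] forces roughly [p ^ 2 >= (4/7) 4 ^ n]. A prime
    of [2 ^ n - 1] could satisfy this, but a prime of [(2 ^ n + 1) / 3] cannot. *)
Lemma odd2_absurd k : a = k.*2.+1 ->
  (forall p x y, 3 < p -> ratio_ge N p x y ->
     4 * (2 ^ k.+1 * 2 ^ k.+1 * x) <= 4 * (2 ^ k.+1 * 2 ^ k.+1 * y) + 7 * (1 * x)) ->
  False.
Proof.
move=> Ek H.
have sdR d : d %| repunit 2 k.+1 -> sigma_dvd N 2 d.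
  by move=> dd; split=> //; rewrite Ek sigma_odd // dvdn_mulr.
have sdS d : d %| (2 ^ k.+1).+1 -> sigma_dvd N 2 d.
  by move=> dd; split=> //; rewrite Ek sigma_odd // dvdn_mull.
move: H sdR sdS; have : 2 < k.+1 by lia.
move: (k.+1) => n n3 H sdR sdS.
have := @expn_modP 2 5 4 (fun r x => ((r == 0) ==> (x == 1)) && ((r == 2) ==> (x == 4))) n isT (erefl _) isT.
have [->/= /andP[/eqP E _]|[->/= /eqP E|on]] : n %% 4 = 0 \/ n %% 4 = 2 \/ odd n by lia.
- by apply: (@sigma_not_dvd5 2) => //; apply: sdR; apply: mod_dvd_repunit.
- by apply: (@sigma_not_dvd5 2) => //; apply: sdS; apply: mod_dvd_expS.
move=> _.
have := @expn_modP 2 7 3 (fun r x => (r == 0) ==> (x == 1)) n isT (erefl _) isT.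
have [->/= /eqP E|n3' _] : n %% 3 = 0 \/ n %% 3 != 0 by lia.
  by apply: not_dvd7; apply: (prime_dvd_triperfect TN (p := 2)) => //; apply: sdR; apply: mod_dvd_repunit.
have := @expn_modP 2 9 6 (fun r x => ((r == 1) ==> (x == 2)) && ((r == 5) ==> (x == 5))) n isT (erefl _) isT.
have P8 : 8 <= 2 ^ n := @exp_ge 2 3 n isT n3.
move=> M9.
(* For [n] prime to 6, [2 ^ n + 1] contains exactly one factor 3. *)
have [t [Et t3]] : exists t, 3 * t = (2 ^ n).+1 /\ ~~ (3 %| t).
  have [E|E] : n %% 6 = 1 \/ n %% 6 = 5 by lia.
    by move: M9; rewrite E /= andbT => /eqP E9; exists ((2 ^ n).+1 %/ 3); lia.
  by move: M9; rewrite E /= => /eqP E9; exists ((2 ^ n).+1 %/ 3); lia.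
have ot : odd t by have : 2 ^ n = 2 * 2 ^ n.-1 by [rewrite -expnS prednK //; lia]; lia.
have t_gt1 : 1 < t by lia.
have p_pr := pdiv_prime t_gt1; have p_dvd := pdiv_dvd t.
have p3 := prime_gt3 p_pr p_dvd ot t3.
have pN : pdiv t %| N.
  apply: (prime_dvd_triperfect TN (p := 2)) => //; first by lia.
  by apply: sdS; rewrite -Et dvdn_mull.
have := H _ _ _ p3 (ratio_ge_any TN pN p_pr).
have : pdiv t <= t by apply: dvdn_leq => //; lia.
rewrite -mulnn; move: (pdiv t) (2 ^ n) Et P8 => p P Et P8 pt K.
have K1 : 4 * (P * P) <= 7 * (p * p + 1) by nia.
have K2 : 9 * (p * p) <= P.+1 * P.+1 by nia.
nia.
Qed.

Lemma even3_absurd k : b = k.*2 ->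
  (forall p x y, 3 < p -> ratio_ge N p x y ->
     3 * (3 * (3 ^ k * 3 ^ k) * x) <= 3 * (3 * (3 ^ k * 3 ^ k) * y) + 7 * ((2 * 3 ^ k).+1 * x)) ->
  False.
Proof.
move=> Ek H; have k3 : 2 < k by lia.
have P8 : 27 <= 3 ^ k := @exp_ge 3 3 k isT k3.
(* With [P = 3 ^ k], [H] gives [2 (y + 1) >= 18 P^2 / (7 (2 P + 1))], which exceeds [P + 1]. *)
have small p y : 3 < p -> ratio_ge N p y.+1 y -> 2 * y < 3 ^ k -> False.
  move=> p3 /(H _ _ _ p3) K yP.
  have : (2 * 3 ^ k).+1 * (2 * y.+1) <= (2 * 3 ^ k).+1 * (3 ^ k).+1.
    by rewrite leq_mul2l; apply/orP; right; lia.
  move: (3 ^ k) P8 K => P P8 K K2.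
  have : 27 * P <= P * P by rewrite leq_mul2r P8 orbT.
  nia.
have sdR d : d %| repunit 3 k -> sigma_dvd N 3 d.
  by move=> dd; split=> //; rewrite Ek sigma_even ?dvdn_mulr //; lia.
have RE := repunit3 k.
case: (even_or_odd k) => [[i Ei]|[i Ei]]; subst k.
  case oi: (odd i); last first.
    apply: (@sigma_not_dvd5 3) => //; apply: sdR; apply: mod_dvd_repunit => //.
    have := @expn_modP 3 5 4 (fun r x => (r == 0) ==> (x == 1)) i.*2 isT (erefl _) isT.
    by have -> /= : i.*2 %% 4 == 0 by [lia]; move/eqP.
  have i3 : 2 < i by lia.
  have Ri := repunit3 i; have := @exp_ge 3 3 i isT i3; rewrite -Ri => R7.
  have or := odd_repunit3 oi; have r3 := @repunit3_mod3 i ltac:(lia).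
  set r := repunit 3 i in Ri R7 or r3; have r_gt1 : 1 < r by lia.
  have p_pr := pdiv_prime r_gt1; have p_dvd := pdiv_dvd r.
  have p3 : 3 < pdiv r by apply: (prime_gt3 p_pr p_dvd).
  have pN : pdiv r %| N.
    apply: (prime_dvd_triperfect TN (p := 3)) => //; first by lia.
    by apply: sdR; rewrite -addnn repunitD -mulSn dvdn_mull.
  apply: (small _ (pdiv r ^ 2) p3); first by have := ratio_ge_any TN pN p_pr; rewrite addn1.
  rewrite double_exp -Ri -mulnn; have : pdiv r <= r by apply: dvdn_leq => //; lia.
  by move=> ?; nia.
have ok : odd i.*2.+1 by rewrite /= odd_double.
set k := i.*2.+1 in Ek H k3 P8 small sdR RE ok *.
have or := odd_repunit3 ok; have r3 := @repunit3_mod3 k isT.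
set r := repunit 3 k in RE or r3.
have r_gt1 : 1 < r by lia.
have p3 p : prime p -> p %| r -> 3 < p by move=> p_pr pr; apply: (prime_gt3 p_pr pr).
have pN p : prime p -> p %| r -> p %| N.
  move=> p_pr pr; apply: (prime_dvd_triperfect TN (p := 3)) => //; last exact: sdR.
  by have := p3 _ p_pr pr; lia.
have [r_pr|r_npr] := boolP (prime r); last first.
  have p_pr := pdiv_prime r_gt1; have p_dvd := pdiv_dvd r.
  apply: (small (pdiv r) (pdiv r ^ 2)); first exact: p3.
    by have := ratio_ge_any TN (pN _ p_pr p_dvd) p_pr; rewrite addn1.
  by have := pdiv_small r_gt1 r_npr; lia.
have [Er|/eqP Er] := logn r N =P 2; last first.
  apply: (small r r); [exact: p3|exact: ratio_ge_n2 (pN _ r_pr (dvdnn _)) Er r_pr|by lia].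
have := @expn_modP 3 5 4 (fun r x => ((r == 1) ==> (x == 3)) && ((r == 3) ==> (x == 2))) k isT (erefl _) isT.
have [k1|k1] : k %% 4 = 1 \/ k %% 4 = 3 by lia.
  rewrite k1 /= andbT => /eqP E.
  apply: (@sigma_not_dvd5 3) => //; split=> //; rewrite Ek sigma_even //; apply: dvdn_mull.
  by apply: mod_dvd_expS => //; rewrite expnS -modnMmr E.
rewrite k1 /= => /eqP E.
(* [r = 13] means [k = 3], settled by [logn3_neq6]; [r = 17] would need [3 ^ k = 35]. *)
have r13 : r != 13.
  apply/negP => /eqP r13; apply: logn3_neq6; rewrite Ek.
  have : 3 ^ k = 3 ^ 3 by rewrite -RE r13.
  by move/eqP; rewrite eqn_exp2l // => /eqP ->.
have E8 : 3 ^ k = 3 * 3 ^ k.-1 by rewrite -expnS.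
apply: (@sigma_not_dvd5 r) => //; first by lia.
split=> //; rewrite Er sigma_prime_sqr //.
have [c Ec] : exists c, r = 5 * c + 3 by exists (r %/ 5); lia.
rewrite Ec -mulnn; apply/dvdnP; exists (5 * c * c + 6 * c + 2); lia.
Qed.

(** Unlike at 2, the repunit suffices: [p <= (3 ^ n - 1) / 2] contradicts the bound
    [p ^ 2 + 1 >= (3/7) 9 ^ n]. *)
Lemma odd3_absurd k : b = k.*2.+1 ->
  (forall p x y, 3 < p -> ratio_ge N p x y ->
     3 * (3 ^ k.+1 * 3 ^ k.+1 * x) <= 3 * (3 ^ k.+1 * 3 ^ k.+1 * y) + 7 * (1 * x)) ->
  False.
Proof.
move=> Ek H.
have sdR d : d %| repunit 3 k.+1 -> sigma_dvd N 3 d.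
  by move=> dd; split=> //; rewrite Ek sigma_odd // dvdn_mulr.
have sdS d : d %| (3 ^ k.+1).+1 -> sigma_dvd N 3 d.
  by move=> dd; split=> //; rewrite Ek sigma_odd // dvdn_mull.
move: H sdR sdS; have : 2 < k.+1 by lia.
move: (k.+1) => n n3 H sdR sdS.
have := @expn_modP 3 5 4 (fun r x => ((r == 0) ==> (x == 1)) && ((r == 2) ==> (x == 4))) n isT (erefl _) isT.
have [->/= /andP[/eqP E _]|[->/= /eqP E|on]] : n %% 4 = 0 \/ n %% 4 = 2 \/ odd n by lia.
- by apply: (@sigma_not_dvd5 3) => //; apply: sdR; apply: mod_dvd_repunit.
- by apply: (@sigma_not_dvd5 3) => //; apply: sdS; apply: mod_dvd_expS.
move=> _.
have P8 : 27 <= 3 ^ n := @exp_ge 3 3 n isT n3.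
have RE := repunit3 n.
have or := odd_repunit3 on; have r3 := @repunit3_mod3 n ltac:(lia).
set r := repunit 3 n in RE or r3.
have r_gt1 : 1 < r by lia.
have p_pr := pdiv_prime r_gt1; have p_dvd := pdiv_dvd r.
have p3 := prime_gt3 p_pr p_dvd or r3.
have pN : pdiv r %| N.
  apply: (prime_dvd_triperfect TN (p := 3)) => //; first by lia.
  by apply: sdR.
have := H _ _ _ p3 (ratio_ge_any TN pN p_pr).
have : pdiv r <= r by apply: dvdn_leq => //; lia.
rewrite -mulnn; move: (pdiv r) (3 ^ n) RE P8 => p P Et P8 pt K.
have K1 : 3 * (P * P) <= 7 * (p * p + 1) by nia.
have K2 : 4 * (p * p) <= P.-1 * P.-1 by nia.
nia.
Qed.

Lemma large_absurd : False.
Proof.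
have [n2 [d2 [R2 l2 d2_gt0 H2]]] : exists n2 d2, [/\ ratio_ge N 2 (2 * (d2 - n2)) d2,
    n2 <= d2, 0 < d2 &
    (forall p x y, 3 < p -> ratio_ge N p x y ->
       4 * (d2 * x) <= 4 * (d2 * y) + 7 * (n2 * x)) -> False].
  case: (even_or_odd a) => [[k Ek]|[k Ek]].
    exists (2 ^ k).+1, (2 * (2 ^ k * 2 ^ k)); split; last exact: even2_absurd.
    - split=> //; rewrite Ek sigma2_even ?double_exp; last by lia.
      have : 0 < 2 ^ k by rewrite expn_gt0.
      move: (2 ^ k) => [|x] //= _.
      have -> : 2 * (x.+1 * x.+1) - x.+2 = x * (2 * x.+1).+1 by nia.
      nia.
    - by have : 0 < 2 ^ k by [rewrite expn_gt0]; move: (2 ^ k) => P; nia.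
    - by rewrite !muln_gt0 expn_gt0.
  exists 1, (2 ^ k.+1 * 2 ^ k.+1); split; last exact: odd2_absurd.
  - split=> //; rewrite Ek sigma2_odd.
    have : 2 * 2 ^ k.*2.+1 = 2 ^ k.+1 * 2 ^ k.+1 by rewrite -expnS -expnD; congr (_ ^ _); lia.
    have : 0 < 2 ^ k.+1 by rewrite expn_gt0.
    move: (2 ^ k.+1) (2 ^ k.*2.+1) => [|P] E //= _ EP.
    have -> : P.+1 * P.+1 - 1 = P * P.+2 by nia.
    by rewrite -EP; lia.
  - by rewrite muln_gt0 expn_gt0.
  - by rewrite muln_gt0 expn_gt0.
have [n3 [d3 [R3 l3 d3_gt0 H3]]] : exists n3 d3, [/\ ratio_ge N 3 (3 * (d3 - n3)) (2 * d3),
    n3 <= d3, 0 < d3 &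
    (forall p x y, 3 < p -> ratio_ge N p x y ->
       3 * (d3 * x) <= 3 * (d3 * y) + 7 * (n3 * x)) -> False].
  case: (even_or_odd b) => [[k Ek]|[k Ek]].
    exists (2 * 3 ^ k).+1, (3 * (3 ^ k * 3 ^ k)); split; last exact: even3_absurd.
    - split=> //; rewrite Ek; have := @sigma3_even k ltac:(lia); rewrite double_exp.
      have : 0 < 3 ^ k by rewrite expn_gt0.
      move: (3 ^ k) (sigma_biunitary _) => [|x] s //= _ Es.
      have -> : 3 * (x.+1 * x.+1) - (2 * x.+1).+1 = 2 * s by nia.
      lia.
    - by have : 0 < 3 ^ k by [rewrite expn_gt0]; move: (3 ^ k) => P; nia.
    - by rewrite !muln_gt0 expn_gt0.
  exists 1, (3 ^ k.+1 * 3 ^ k.+1); split; last exact: odd3_absurd.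
  - split=> //; rewrite Ek; have := sigma3_odd k.
    have : 3 * 3 ^ k.*2.+1 = 3 ^ k.+1 * 3 ^ k.+1 by rewrite -expnS -expnD; congr (_ ^ _); lia.
    have : 0 < 3 ^ k.+1 by rewrite expn_gt0.
    move: (3 ^ k.+1) (3 ^ k.*2.+1) (sigma_biunitary _) => [|P] E s //= _ EP Es.
    have -> : P.+1 * P.+1 - 1 = 2 * s by nia.
    by rewrite -EP; lia.
  - by rewrite muln_gt0 expn_gt0.
  - by rewrite muln_gt0 expn_gt0.
case: (leqP (4 * (n3 * d2)) (3 * (n2 * d3))) => H.
  by apply: H2 => p x y; apply: (deficit2 R2 R3).
by apply: H3 => p x y; apply: (deficit3 R2 R3) => //; apply: ltnW.
Qed.
End Large.

(** * Exponent of 2 equal to 4 *)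

(** Turns the finite search below [n] into a boolean evaluation. *)
Lemma iota_lower_bound n (P : pred nat) p : all (fun q => ~~ P q) (iota 0 n) -> P p -> n <= p.
Proof.
move=> /allP H Pp; rewrite leqNgt; apply/negP => lt.
by have := H p; rewrite mem_iota Pp lt => /(_ isT).
Qed.

(** [x] has order 8 modulo [u]. The proof avoids orders: otherwise some multiple of [u - 1] is [4e]
    with [e] odd, and [x ^ (4e)] would be both 1 and -1. *)
Lemma dvd_quartic_mod8 u x : prime u -> odd u -> u %| (x ^ 4).+1 -> u %% 8 = 1.
Proof.
move=> u_pr ou ux.
have co : coprime x u.
  rewrite coprime_sym prime_coprime //; apply/negP => d.
  have : u %| x ^ 4 by rewrite Euclid_dvdX // d.
  by move=> /(dvdn_addr 1); rewrite addn1 ux dvdn1 => /esym/eqP E; rewrite E in u_pr.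
have fermat : x ^ u.-1 = 1 %[mod u] by rewrite -totient_prime // Euler_exp_totient.
have u_gt1 := prime_gt1 u_pr.
apply/eqP; apply: contraT => /eqP u8.
have [j [e Ee Je]] : exists j, exists2 e, u.-1 * j = 4 * e & odd e.
  clear -ou u_gt1 u8; have [E|E] : u %% 8 = 5 \/ u %% 4 = 3 by lia.
    by exists 1, (u.-1 %/ 4); lia.
  by exists 2, (u.-1 %/ 2); lia.
have d1 : u %| (x ^ (4 * e)).+1.
  by apply: dvdn_trans ux _; rewrite expnM; apply: dvdn_expS_odd.
have : x ^ (4 * e) = 1 %[mod u] by rewrite -Ee expnM -modnXm fermat modnXm exp1n.
rewrite (dvd_expS_mod (prime_gt0 u_pr) d1) modn_small //; clear -ou u_gt1; lia.
Qed.

Lemma prime_power n p : 0 < n -> (forall q, prime q -> q %| n -> q = p) ->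
  exists x, n = p ^ x.
Proof.
move=> n_gt0 H; have : p.-nat n.
  by apply/pnatP => // q q_pr qn; rewrite inE /= (H q q_pr qn) eqxx.
by case/p_natP => x ->; exists x.
Qed.

(** Odd squares are 1 modulo 8, so [p ^ x] is 1 or [p] there. *)
Lemma power_mod8 p x : odd p -> p ^ x %% 8 = 5 -> p %% 8 = 5.
Proof.
move=> op; rewrite -modnXm.
have [->|[->|[->|//]]] : p %% 8 = 1 \/ p %% 8 = 3 \/ p %% 8 = 7 \/ p %% 8 = 5 by lia.
- by rewrite exp1n.
- have := @expn_modP 3 8 2 (fun r x => x != 5) x isT (erefl _) isT.
  by move/eqP.
- have := @expn_modP 7 8 2 (fun r x => x != 5) x isT (erefl _) isT.
  by move/eqP.
Qed.

Lemma power_mod8_even p x : p %% 8 = 5 -> p ^ x %% 8 = 1 -> ~~ odd x.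
Proof.
move=> p5; rewrite -modnXm p5.
have := @expn_modP 5 8 2 (fun r x => (r == 1) ==> (x == 5)) x isT (erefl _) isT.
by rewrite modn2; case: (odd x) => //= /eqP ->.
Qed.

Lemma oddn_mod n d : ~~ odd d -> odd (n %% d) = odd n.
Proof. by move=> od; rewrite [in RHS](divn_eq n d) oddD oddM (negPf od) andbF. Qed.

(** [3 ^ n = 1] modulo [p] with [n] odd makes 3 a square modulo [p], which it is not for these
    primes. *)
Lemma repunit3_primes n p : odd n -> p %| repunit 3 n -> p \notin [:: 5; 7; 17; 19].
Proof.
move=> on /(dvd_repunit_mod (isT : 0 < 3)) M; apply/negP; rewrite !inE => /or4P[]/eqP E; subst p.
- have := @expn_modP 3 5 4 (fun r x => odd r ==> (x != 1)) n isT (erefl _) isT.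
  by rewrite M oddn_mod // on.
- have := @expn_modP 3 7 6 (fun r x => odd r ==> (x != 1)) n isT (erefl _) isT.
  by rewrite M oddn_mod // on.
- have := @expn_modP 3 17 16 (fun r x => odd r ==> (x != 1)) n isT (erefl _) isT.
  by rewrite M oddn_mod // on.
- have := @expn_modP 3 19 18 (fun r x => odd r ==> (x != 1)) n isT (erefl _) isT.
  by rewrite M oddn_mod // on.
Qed.

(** -1 is [3 ^ 2] modulo 5 and [3 ^ 3] modulo 7, while modulo 11 and 13 the order of 3 is odd and -1
    is no power of 3. *)
Lemma expS3_odd_primes n q : odd n -> n %% 6 != 3 -> 0 < q -> q %| (3 ^ n).+1 ->
  q \notin [:: 5; 7; 11; 13].
Proof.
move=> on n6 q_gt0 /(dvd_expS_mod q_gt0) M; apply/negP; rewrite !inE => /or4P[]/eqP E; subst q.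
- have := @expn_modP 3 5 4 (fun r x => odd r ==> (x != 4)) n isT (erefl _) isT.
  by rewrite M oddn_mod // on.
- have := @expn_modP 3 7 6 (fun r x => (r != 3) ==> (x != 6)) n isT (erefl _) isT.
  by rewrite M n6.
- have := @expn_modP 3 11 5 (fun r x => (x != 10)) n isT (erefl _) isT.
  by rewrite M.
- have := @expn_modP 3 13 3 (fun r x => (x != 12)) n isT (erefl _) isT.
  by rewrite M.
Qed.

Lemma expS3_quarter n : odd n -> exists t, [/\ 4 * t = (3 ^ n).+1, odd t & ~~ (3 %| t)].
Proof.
move=> on; have M8 := @expn_modP 3 8 2 (fun r x => (r == 1) ==> (x == 3)) n isT (erefl _) isT.
rewrite modn2 on /= in M8; move/eqP: M8 => M8.
have E3 : 3 ^ n = 3 * 3 ^ n.-1 by case: n on {M8} => // n _; rewrite expnS.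
by exists ((3 ^ n).+1 %/ 4); split; lia.
Qed.

Lemma ratio_ge_1 N p : prime p -> ratio_ge N p 1 1.
Proof. by move=> p_pr; split=> //; rewrite !mul1n leq_sigma // expn_gt0 prime_gt0. Qed.

Lemma ratio_le_2n N n p : prime p -> logn p N = 2 -> n <= p ->
  ratio_le N p (n ^ 2 + 1) (n ^ 2).
Proof.
move=> p_pr E le_np; split=> //; rewrite E sigma_prime_sqr //.
have : n ^ 2 <= p ^ 2 by rewrite leq_exp2r.
move: (n ^ 2) (p ^ 2) => x y; nia.
Qed.

Section Four.
Context (N : nat) (TN : triperfect N).
Local Notation a := (logn 2 N).
Local Notation b := (logn 3 N).
Context (a4 : a = 4) (b3 : 2 < b).

Lemma ratio24 : ratio_ge N 2 27 16 /\ ratio_le N 2 27 16.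
Proof. exact: (@ratio_exact N 2 4 27 16 isT a4 sigma_2_4 (erefl _)). Qed.

Lemma ratio3_le : ratio_le N 3 3 2.
Proof. exact: ratio_le_any. Qed.

Lemma two_adic4 l : uniq (unzip1 l) -> all_pair (sigma_dvd N) l ->
  32 %| foldr (fun t z => t.2 * z) 1 l -> False.
Proof. by move=> U H D; have := @two_adic _ TN 5 l U H D; rewrite a4. Qed.

Lemma dvd_prime_gt3 p q : prime q -> 3 < q -> sigma_dvd N p q -> q %| N.
Proof. by move=> q_pr q3; apply: prime_dvd_triperfect; rewrite ?gtn_eqF. Qed.

Lemma a4_logn3_eq3 : b = 3 -> N = 2160.
Proof.
move=> E.
have sd8 : sigma_dvd N 3 8 by split=> //; rewrite E sigma_3_3.
have d5 : 5 %| N.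
  by apply: (@dvd_prime_gt3 3) => //; split=> //; rewrite E sigma_3_3.
have supp q : prime q -> q %| N -> q \in [:: 2; 3; 5].
  move=> q_pr qN; case: (prime_cases q_pr qN) => [->|->|->|q5] //.
  exfalso; apply: (@two_adic4 [:: (3,8); (5,2); (q,2)]) => //; first by rewrite /= !inE; lia.
  do !split=> //; first by apply: sigma_dvd2 => //; apply: logn_triperfect_gt0.
  by have [] := @sigma_dvd_odd _ TN q q_pr ltac:(lia) qN.
have [N_gt0 sN] := TN.
have [K [K_gt0 NE sE HK]] := @sigma_split N [:: 2; 3; 5] N_gt0 isT isT.
have K1 : K = 1.
  case: (ltngtP K 1) => //; first by lia.
  move=> K_gt1; have := HK _ (pdiv_prime K_gt1) (pdiv_dvd K) => /andP[d].
  by rewrite supp ?pdiv_prime.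
move: NE sE; rewrite K1 sN sigma1 !big_cons !big_nil a4 E sigma_2_4 sigma_3_3 !muln1.
have -> : 2 ^ 4 = 16 by [].
have -> : 3 ^ 3 = 27 by [].
have c_gt0 := logn_triperfect_gt0 TN (isT : prime 5) d5.
(* With [c = logn 5 N] the equation reduces to [5 * sigma (5 ^ c) = 6 * 5 ^ c], that is
   [h (5 ^ c) = 6/5]. *)
have [c1|[c2|c3]] : logn 5 N = 1 \/ logn 5 N = 2 \/ 2 < logn 5 N by lia.
- by rewrite c1 => ->.
- by rewrite c2 sigma_prime_sqr // -!mulnn; lia.
have := sigma_gt_ge3 (isT : prime 5) c3; lia.
Qed.

(** [sigma (3 ^ b)] alone uses up [2 ^ 4], so 2 and 3 are the only primes and [h N <= 81/32]. *)
Lemma a4_logn3_mod4_0 k : b = k.*2 -> ~~ odd k -> False.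
Proof.
move=> Ek ok.
have sd16 : sigma_dvd N 3 16.
  split=> //; rewrite Ek sigma_even //; last by lia.
  apply: (dvdn_mul (d1 := 4) (d2 := 4)); last by apply: dvdn_expS_odd; rewrite /= ok.
  by rewrite -(odd_double_half k) (negPf ok) repunit_even.
have := triperfect_le TN (l := [:: (2,27,16); (3,3,2)]) isT
  (conj ratio24.2 (conj ratio3_le I)).
rewrite /nums /dens /= => H; suff : 3 * (16 * (2 * 1)) <= 27 * (3 * 1) by lia.
apply: H => q q_pr qN; rewrite !inE; apply: contraT => qn; exfalso.
apply: (@two_adic4 [:: (3,16); (q,2)]) => //; first by rewrite /= !inE; lia.
by do !split=> //; have [] := @sigma_dvd_odd _ TN q q_pr ltac:(have := prime_gt1 q_pr; lia) qN.
Qed.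

(** [8 * 5] divides [sigma (3 ^ b)], which leaves only the primes 2, 3, 5; then an exact [5 ^ 2] is
    too small and any other exponent too large. *)
Lemma a4_logn3_mod4_3 k : 4 < b -> b = k.*2.+1 -> odd k -> False.
Proof.
move=> b5 Ek ok.
have sd8 : sigma_dvd N 3 8.
  split=> //; rewrite Ek sigma_odd //.
  apply: (dvdn_mul (d1 := 4) (d2 := 2)); last by rewrite dvdn2 /= oddX.
  by rewrite -(odd_double_half k.+1) /= ok repunit_even.
have d5 : 5 %| N.
  apply: (@dvd_prime_gt3 3) => //; split=> //; rewrite Ek sigma_odd //.
  have := @expn_modP 3 5 4 (fun r x => ((r == 0) ==> (x == 1)) && ((r == 2) ==> (x == 4))) k.+1 isT (erefl _) isT.
  have [->/= /andP[/eqP E _]|->/= /eqP E] : k.+1 %% 4 = 0 \/ k.+1 %% 4 = 2 by lia.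
    by apply: dvdn_mulr; apply: mod_dvd_repunit.
  by apply: dvdn_mull; apply: mod_dvd_expS.
have supp q : prime q -> q %| N -> q \in [:: 2; 3; 5].
  move=> q_pr qN; case: (prime_cases q_pr qN) => [->|->|->|q5] //.
  exfalso; apply: (@two_adic4 [:: (3,8); (5,2); (q,2)]) => //; first by rewrite /= !inE; lia.
  do !split=> //; first by apply: sigma_dvd2 => //; apply: logn_triperfect_gt0.
  by have [] := @sigma_dvd_odd _ TN q q_pr ltac:(lia) qN.
have [E|/eqP E] := logn 5 N =P 2.
  have := triperfect_le TN (l := [:: (2,27,16); (3,3,2); (5,26,25)]) isT
    (conj ratio24.2 (conj ratio3_le (conj (@ratio_le_2 N 5 isT E) I))) supp.
  rewrite /nums /dens /=; lia.
have ob : odd b by rewrite Ek /= odd_double.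
have := triperfect_ge TN (l := [:: (2,27,16); (3,364,243); (5,6,5)]) isT
  (conj ratio24.1 (conj (ratio3_odd b5 ob) (conj (ratio_ge_n2 TN d5 E isT) I))).
rewrite /nums /dens /=; lia.
Qed.

(** The factor 4 of [3 ^ n + 1] leaves room for two primes above 3. They are 7 and 13 if [n] is 3
    modulo 6, and too much; otherwise one from each factor, at least 11 and 17, and too little. *)
Lemma a4_logn3_mod4_1 k : 4 < b -> b = k.*2.+1 -> ~~ odd k -> False.
Proof.
move=> b5 Ek ok.
have sd4 : sigma_dvd N 3 4.
  by split=> //; rewrite Ek sigma_odd // dvdn_mull //; apply: dvdn_expS_odd; rewrite /= ok.
have sdR d : d %| repunit 3 k.+1 -> sigma_dvd N 3 d.
  by move=> dd; split=> //; rewrite Ek sigma_odd // dvdn_mulr.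
have sdS d : d %| (3 ^ k.+1).+1 -> sigma_dvd N 3 d.
  by move=> dd; split=> //; rewrite Ek sigma_odd // dvdn_mull.
have on : odd k.+1 by rewrite /= ok.
move: sdR sdS on; have : 2 < k.+1 by lia.
move: (k.+1) => n n3 sdR sdS on.
have supp p q r : prime p -> p %| N -> 3 < p -> prime q -> q %| N -> 3 < q -> p != q ->
    prime r -> r %| N -> r \in [:: 2; 3; p; q].
  move=> p_pr pN p3 q_pr qN q3 pq r_pr rN; apply: contraT; rewrite !inE => H; exfalso.
  have r_gt1 := prime_gt1 r_pr.
  apply: (@two_adic4 [:: (3,4); (p,2); (q,2); (r,2)]) => //; first by rewrite /= !inE; lia.
  do !split=> //.
  - by have [] := @sigma_dvd_odd _ TN p p_pr ltac:(lia) pN.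
  - by have [] := @sigma_dvd_odd _ TN q q_pr ltac:(lia) qN.
  - by have [] := @sigma_dvd_odd _ TN r r_pr ltac:(lia) rN.
have [E3|E3] : n %% 6 = 3 \/ n %% 6 != 3 by lia.
  have d7 : 7 %| N.
    apply: (@dvd_prime_gt3 3) => //; apply: sdS; apply: mod_dvd_expS => //.
    have := @expn_modP 3 7 6 (fun r x => (r == 3) ==> (x == 6)) n isT (erefl _) isT.
    by rewrite E3 /= => /eqP.
  have d13 : 13 %| N.
    apply: (@dvd_prime_gt3 3) => //; apply: sdR; apply: mod_dvd_repunit => //.
    have := @expn_modP 3 13 3 (fun r x => (r == 0) ==> (x == 1)) n isT (erefl _) isT.
    by have -> /= : n %% 3 == 0 by [lia]; move/eqP.
  have n5 : ~~ (5 %| N).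
    by apply/negP => d5; have := @supp 7 13 5 isT d7 isT isT d13 isT isT isT d5.
  have E7 : logn 7 N != 2.
    apply: contraNneq n5 => E; apply: (@dvd_prime_gt3 7) => //.
    by apply: sigma_dvd_trans (sigma_dvd_2 _ E).
  have E13 : logn 13 N != 2.
    apply: contraNneq n5 => E; apply: (@dvd_prime_gt3 13) => //.
    by apply: sigma_dvd_trans (sigma_dvd_2 _ E).
  have := triperfect_ge TN (l := [:: (2,27,16); (3,1066,729); (7,8,7); (13,14,13)]) isT
    (conj ratio24.1 (conj (ratio3_ge5 b5) (conj (ratio_ge_n2 TN d7 E7 isT)
    (conj (ratio_ge_n2 TN d13 E13 isT) I)))).
  rewrite /nums /dens /=; lia.
have RE := repunit3 n; have P27 : 27 <= 3 ^ n := @exp_ge 3 3 n isT n3.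
have or := odd_repunit3 on; have r3 := @repunit3_mod3 n ltac:(lia).
have r_gt1 : 1 < repunit 3 n by lia.
have p_pr := pdiv_prime r_gt1; have p_dvd := pdiv_dvd (repunit 3 n).
have p3 := prime_gt3 p_pr p_dvd or r3.
have pM := dvd_repunit_mod (isT : 0 < 3) p_dvd.
move: (pdiv _) p_pr p_dvd p3 pM => p p_pr p_dvd p3 pM.
have pN : p %| N by apply: (@dvd_prime_gt3 3) => //; apply: sdR.
have p11 : 11 <= p.
  apply: (@iota_lower_bound 11 (fun x => prime x && (x \notin [:: 2; 3; 5; 7]))) => //.
  have := repunit3_primes on p_dvd; rewrite p_pr !inE !negb_or => /and4P[-> -> _ _].
  by rewrite !(gtn_eqF (leq_trans _ p3)).
have [t [Et ot t3]] := expS3_quarter on.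
have t_gt1 : 1 < t by clear -Et P27; lia.
have q_pr := pdiv_prime t_gt1; have q_dvd := pdiv_dvd t.
have q3 := prime_gt3 q_pr q_dvd ot t3.
have qS : pdiv t %| (3 ^ n).+1 by rewrite -Et dvdn_mull.
have qM := dvd_expS_mod (prime_gt0 q_pr) qS.
move: (pdiv _) q_pr q_dvd q3 qS qM => q q_pr q_dvd q3 qS qM.
have qN : q %| N by apply: (@dvd_prime_gt3 3) => //; apply: sdS.
have q17 : 17 <= q.
  apply: (@iota_lower_bound 17 (fun x => prime x && (x \notin [:: 2; 3; 5; 7; 11; 13]))) => //.
  have := expS3_odd_primes on E3 (prime_gt0 q_pr) qS; rewrite q_pr !inE !negb_or => /and4P[-> -> -> ->].
  by rewrite !(gtn_eqF (leq_trans _ q3)).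
have pq : p != q.
  by apply/negP => /eqP E; move: pM; rewrite E qM modn_small; clear -q3; lia.
have U : uniq [:: 2; 3; p; q] by clear -pq p3 q3; rewrite /= !inE; lia.
have := triperfect_le TN (l := [:: (2,27,16); (3,3,2); (p,11,10); (q,17,16)]) U
  (conj ratio24.2 (conj ratio3_le (conj (@ratio_le_any N 11 p p_pr p11)
  (conj (@ratio_le_any N 17 q q_pr q17) I)))) (fun r => @supp p q r p_pr pN p3 q_pr qN q3 pq).
rewrite /nums /dens /=; clear; lia.
Qed.
End Four.

(** * Exponent of 2 equal to 4, exponent of 3 twice an odd number *)

Definition large_prime N p := [&& prime p, p %| N & 3 < p].

Lemma iota_forall n (P Q : pred nat) p : all (fun q => P q ==> Q q) (iota 0 n) ->
  p < n -> P p -> Q p.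
Proof. by move=> /allP H lt Pp; have := H p; rewrite mem_iota Pp; apply. Qed.

Lemma expS_half x : 1 < x -> x %% 4 = 1 -> exists t, [/\ 2 * t = x.+1, odd t & 1 < t].
Proof. by move=> x_gt1 x4; exists (x.+1 %/ 2); split; lia. Qed.

Lemma expS_half_prime x : 1 < x -> x %% 4 = 1 -> x %% 3 != 2 ->
  exists u, [/\ prime u, u %| x.+1 & 3 < u].
Proof.
move=> x_gt1 x4 x3; have [t [Et ot t_gt1]] := expS_half x_gt1 x4.
have u_pr := pdiv_prime t_gt1; have u_dvd := pdiv_dvd t.
exists (pdiv t); split=> //; first by rewrite -Et dvdn_mull.
apply: (prime_gt3 u_pr u_dvd ot); clear -Et x3; lia.
Qed.

Section FourOdd.
Context (N : nat) (TN : triperfect N).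
Local Notation a := (logn 2 N).
Local Notation b := (logn 3 N).
Local Notation bp := (large_prime N).
Context (a4 : a = 4) (b3 : 2 < b).

Lemma sigma_dvd_large p : bp p -> sigma_dvd N p 2.
Proof. by case/and3P=> p_pr pN p3; apply: sigma_dvd_odd => //; apply: ltnW. Qed.

Lemma large_prime_sigma_dvd p q : prime q -> 3 < q -> sigma_dvd N p q -> bp q.
Proof. by move=> q_pr q3 sd; rewrite /large_prime q_pr q3 (dvd_prime_gt3 TN q_pr q3 sd). Qed.

(* A fourth prime larger than 3 would make [2 ^ 5] divide [sigma_biunitary N]. *)
Lemma support3 p q r s : bp p -> bp q -> bp r -> uniq [:: p; q; r] ->
  prime s -> s %| N -> s \in [:: 2; 3; p; q; r].
Proof.
move=> bpp bpq bpr U s_pr sN; apply: contraT => sn; exfalso.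
have s_gt1 := prime_gt1 s_pr.
have sd : sigma_dvd N s 2.
  apply: sigma_dvd_odd => //; move: sn; rewrite !inE; clear -s_gt1; lia.
apply: (two_adic4 TN a4 (l := [:: (3,2); (p,2); (q,2); (r,2); (s,2)])) => //.
  case/and3P: bpp bpq bpr => _ _ p3 /and3P[_ _ q3] /and3P[_ _ r3].
  move: U sn; rewrite /= !inE; clear -p3 q3 r3; lia.
exact: (conj (sigma_dvd_3 TN b3) (conj (sigma_dvd_large bpp) (conj (sigma_dvd_large bpq)
  (conj (sigma_dvd_large bpr) (conj sd I))))).
Qed.

Lemma support3_large p q r s : bp p -> bp q -> bp r -> uniq [:: p; q; r] ->
  bp s -> s \in [:: p; q; r].
Proof.
move=> bpp bpq bpr U /and3P[s_pr sN s3].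
have := support3 bpp bpq bpr U s_pr sN; rewrite !inE.
by rewrite (gtn_eqF s3) (gtn_eqF (ltnW s3)).
Qed.

(** 3, [p], [q], [r] already account for all four factors 2. *)
Lemma not4 p q r : bp p -> bp q -> bp r -> uniq [:: p; q; r] -> sigma_dvd N p 4 -> False.
Proof.
move=> bpp bpq bpr U sd.
apply: (two_adic4 TN a4 (l := [:: (3,2); (p,4); (q,2); (r,2)])) => //.
  case/and3P: bpp bpq bpr => _ _ p3 /and3P[_ _ q3] /and3P[_ _ r3].
  move: U; rewrite /= !inE; clear -p3 q3 r3; lia.
exact: (conj (sigma_dvd_3 TN b3) (conj sd (conj (sigma_dvd_large bpq)
  (conj (sigma_dvd_large bpr) I)))).
Qed.

Lemma uniq23 p q r : bp p -> bp q -> bp r -> uniq [:: p; q; r] -> uniq [:: 2; 3; p; q; r].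
Proof.
case/and3P=> _ _ p3 /and3P[_ _ q3] /and3P[_ _ r3].
rewrite /= !inE; clear -p3 q3 r3; lia.
Qed.

Lemma le3_gen x3 y3 p q r xp yp xq yq xr yr : bp p -> bp q -> bp r -> uniq [:: p; q; r] ->
  ratio_le N 3 x3 y3 ->
  ratio_le N p xp yp -> ratio_le N q xq yq -> ratio_le N r xr yr ->
  48 * (y3 * (yp * (yq * yr))) <= 27 * (x3 * (xp * (xq * xr))).
Proof.
move=> bpp bpq bpr U R3 Rp Rq Rr.
have := triperfect_le TN (l := [:: (2,27,16); (3,x3,y3); (p,xp,yp); (q,xq,yq); (r,xr,yr)])
  (uniq23 bpp bpq bpr U)
  (conj (ratio24 a4).2 (conj R3 (conj Rp (conj Rq (conj Rr I)))))
  (fun s => support3 bpp bpq bpr U (s := s)).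
rewrite /nums /dens /=; clear; lia.
Qed.

Lemma ge3_gen x3 y3 p q r xp yp xq yq xr yr : bp p -> bp q -> bp r -> uniq [:: p; q; r] ->
  ratio_ge N 3 x3 y3 ->
  ratio_ge N p xp yp -> ratio_ge N q xq yq -> ratio_ge N r xr yr ->
  27 * (x3 * (xp * (xq * xr))) <= 48 * (y3 * (yp * (yq * yr))).
Proof.
move=> bpp bpq bpr U R3 Rp Rq Rr.
have := triperfect_ge TN (l := [:: (2,27,16); (3,x3,y3); (p,xp,yp); (q,xq,yq); (r,xr,yr)])
  (uniq23 bpp bpq bpr U)
  (conj (ratio24 a4).1 (conj R3 (conj Rp (conj Rq (conj Rr I))))).
rewrite /nums /dens /=; clear; lia.
Qed.

Lemma le3 p q r xp yp xq yq xr yr : bp p -> bp q -> bp r -> uniq [:: p; q; r] ->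
  ratio_le N p xp yp -> ratio_le N q xq yq -> ratio_le N r xr yr ->
  32 * (yp * (yq * yr)) <= 27 * (xp * (xq * xr)).
Proof.
move=> bpp bpq bpr U Rp Rq Rr.
have := le3_gen bpp bpq bpr U (ratio3_le N) Rp Rq Rr; clear; lia.
Qed.

Lemma ex_third_prime p q xp yp xq yq : bp p -> bp q -> p != q ->
  ratio_le N p xp yp -> ratio_le N q xq yq -> 27 * (xp * xq) < 32 * (yp * yq) ->
  exists2 r, bp r & uniq [:: p; q; r].
Proof.
move=> bpp bpq pq Rp Rq H.
have /and3P[_ _ p3] := bpp; have /and3P[_ _ q3] := bpq.
have [/hasP[r]|] := boolP (has (fun r => r \notin [:: 2; 3; p; q]) (primes N)).
  rewrite mem_primes => /and3P[r_pr _ rN] rn; exists r.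
    rewrite /large_prime r_pr rN /=; move: rn (prime_gt1 r_pr); rewrite !inE; clear; lia.
  by move: rn; rewrite /= !inE; clear -pq; lia.
rewrite -all_predC => /allP S.
have U : uniq [:: 2; 3; p; q] by rewrite /= !inE; clear -pq p3 q3; lia.
have := triperfect_le TN (l := [:: (2,27,16); (3,3,2); (p,xp,yp); (q,xq,yq)]) U
  (conj (ratio24 a4).2 (conj (ratio3_le N) (conj Rp (conj Rq I)))).
rewrite /nums /dens /= => K.
suff S' : forall q0, prime q0 -> q0 %| N -> q0 \in [:: 2; 3; p; q].
  by move: (K S') H; clear; lia.
move=> s s_pr sN; have := S s; rewrite mem_primes s_pr sN /= (TN.1) negbK.
exact.
Qed.

(** Applied where [p + 1] is a multiple of 4, against [not4], or of an excluded prime, as 7 for 13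
    and 41; exponents below 6 then disappear. *)
Lemma ratio_ge_even_exp p : bp p -> ~ sigma_dvd N p p.+1 -> logn p N != 2 ->
  ratio_ge N p (p * p + p + 1) (p * p) /\ exists m, [/\ odd m, 2 < m & logn p N = m.*2].
Proof.
move=> /and3P[p_pr pN p3] nd n2; case: (sigma_dvd_S TN p_pr pN) => [//|[m om Em]].
have m3 : 2 < m by move: n2; rewrite Em; clear -om; lia.
split; last by exists m.
by apply: ratio_ge_5 => //; rewrite Em; clear -m3; lia.
Qed.

Context (k : nat) (Ek : b = k.*2) (ok : odd k).

Lemma k_gt1 : 1 < k. Proof. by move: b3; rewrite Ek; clear -ok; lia. Qed.

Lemma sigma_dvd_repunit d : d %| repunit 3 k -> sigma_dvd N 3 d.
Proof. by move=> dd; split=> //; rewrite Ek sigma_even ?dvdn_mulr // ltnW ?k_gt1. Qed.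

Lemma sigma_dvd_expS d : d %| (3 ^ k.+1).+1 -> sigma_dvd N 3 d.
Proof. by move=> dd; split=> //; rewrite Ek sigma_even ?dvdn_mull // ltnW ?k_gt1. Qed.

Lemma repunit_large_prime p : prime p -> p %| repunit 3 k -> bp p.
Proof.
move=> p_pr pr; have p3 := prime_gt3 p_pr pr (odd_repunit3 ok) (repunit3_mod3 (ltnW k_gt1)).
exact: large_prime_sigma_dvd (sigma_dvd_repunit pr).
Qed.

Lemma expS3_even_mod4 : 3 ^ k.+1 %% 4 = 1.
Proof.
have := @expn_modP 3 4 2 (fun r x => (r == 0) ==> (x == 1)) k.+1 isT (erefl _) isT.
by rewrite modn2 /= ok => /eqP.
Qed.

Lemma ex_prime_repunit : exists2 p, bp p & p %| repunit 3 k.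
Proof.
have r_gt1 : 1 < repunit 3 k by apply: leq_trans (repunit_ge2 3 k_gt1).
by exists (pdiv (repunit 3 k)); rewrite ?pdiv_dvd // repunit_large_prime ?pdiv_prime ?pdiv_dvd.
Qed.

Lemma ex_prime_expS : exists2 q, bp q & q %| (3 ^ k.+1).+1.
Proof.
have P9 : 9 <= 3 ^ k.+1 := @exp_ge 3 2 k.+1 isT (leqW k_gt1).
have [|||u [u_pr ud u3]] := @expS_half_prime (3 ^ k.+1).
- exact: leq_trans P9.
- exact: expS3_even_mod4.
- by rewrite expnS mulnC modnMl.
by exists u => //; apply: large_prime_sigma_dvd (sigma_dvd_expS ud).
Qed.

(** A common prime would have [3 ^ k = 1] and [3 ^ k.+1 = -1], hence divide 4. *)
Lemma repunit_expS_neq p q : 3 < p -> p %| repunit 3 k -> q %| (3 ^ k.+1).+1 -> p != q.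
Proof.
move=> p3 pr qS; apply/negP => /eqP E; subst q.
have M := dvd_repunit_mod (isT : 0 < 3) pr.
have := dvd_expS_mod (ltnW (ltnW (ltnW p3))) qS.
rewrite expnS -modnMmr M modnMmr muln1 (modn_small p3) => E.
have {E}E : p = 4 by clear -E p3; lia.
have := odd_repunit3 ok; case/dvdnP: pr => c ->; rewrite E oddM andbF; done.
Qed.

Lemma large_prime_ge11 p : bp p -> p != 5 -> p != 7 -> 11 <= p.
Proof.
move=> /and3P[p_pr _ p3] n5 n7.
apply: (@iota_lower_bound 11 (fun x => prime x && (x \notin [:: 2; 3; 5; 7]))) => //.
by rewrite p_pr !inE (negPf n5) (negPf n7) !(gtn_eqF (leq_trans _ p3)).
Qed.

Lemma large_prime_ge17 p : bp p -> p != 5 -> p != 7 -> p != 11 -> p != 13 -> 17 <= p.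
Proof.
move=> bpp n5 n7 n11 n13; have p11 := large_prime_ge11 bpp n5 n7; case/and3P: bpp => p_pr _ _.
apply: (@iota_lower_bound 17 (fun x => prime x && (11 <= x) && (x \notin [:: 11; 13]))) => //.
by rewrite p_pr !inE (negPf n11) (negPf n13) p11.
Qed.

Lemma large_prime_sqr_dvd p q : prime p -> logn p N = 2 -> prime q -> 3 < q -> q %| p ^ 2 + 1 -> bp q.
Proof.
move=> p_pr E q_pr q3 qd; apply: large_prime_sigma_dvd => //.
exact: sigma_dvd_trans qd (sigma_dvd_2 p_pr E).
Qed.

(** [sigma (3 ^ 6)] forces 13 and 41. Each choice of the third prime [r] makes the product miss 3,
    above or below. *)
Lemma a4_logn3_neq6 : k = 3 -> False.
Proof.
move=> k3; have b6 : b = 6 by rewrite Ek k3.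
have [G3 L3] := @ratio_exact N 3 6 1066 729 isT b6 sigma_3_6 ltac:(by vm_compute).
have bp13 : bp 13 by apply: (@large_prime_sigma_dvd 3) => //; split=> //; rewrite b6 sigma_3_6.
have bp41 : bp 41 by apply: (@large_prime_sigma_dvd 3) => //; split=> //; rewrite b6 sigma_3_6.
have d13 : 13 %| N by case/and3P: bp13.
have d41 : 41 %| N by case/and3P: bp41.
have L13 := @ratio_le_any N 13 13 isT isT.
have L41 := @ratio_le_any N 41 41 isT isT.
have [r bpr U] := ex_third_prime bp13 bp41 isT L13 L41 ltac:(clear; lia).
have /and3P[r_pr rN r3] := bpr.
have mem s : bp s -> s != 13 -> s != 41 -> s = r.
  move=> bps n1 n2; have := support3_large bp13 bp41 bpr U bps.
  by rewrite !inE (negPf n1) (negPf n2) => /eqP.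
have LE := le3_gen bp13 bp41 bpr U L3.
have GE := ge3_gen bp13 bp41 bpr U G3.
have E13 : logn 13 N != 2.
  apply/negP => /eqP E; have bp17 := @large_prime_sqr_dvd 13 17 isT E isT isT isT.
  have r17 := mem _ bp17 isT isT.
  have := LE _ _ _ _ _ _ (@ratio_le_2 N 13 isT E) L41 (@ratio_le_any N 17 r r_pr ltac:(by rewrite -r17)).
  clear; lia.
have E41 : logn 41 N != 2.
  apply/negP => /eqP E; have bp29 := @large_prime_sqr_dvd 41 29 isT E isT isT isT.
  have r29 := mem _ bp29 isT isT.
  have := LE _ _ _ _ _ _ L13 (@ratio_le_2 N 41 isT E) (@ratio_le_any N 29 r r_pr ltac:(by rewrite -r29)).
  clear; lia.
have U' : uniq [:: r; 13; 41] by move: U; rewrite /= !inE; clear; lia.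
have [r7|/eqP n7] := r =P 7.
  subst r; have E7 : logn 7 N != 2.
    apply/negP => /eqP E; have bp5 := @large_prime_sqr_dvd 7 5 isT E isT isT isT.
    by have := mem _ bp5 isT isT.
  have [|R7 _] := ratio_ge_even_exp bpr _ E7.
    by move=> sd; apply: (not4 bpr bp13 bp41 U'); apply: sigma_dvd_trans sd.
  have := GE _ _ _ _ _ _ (ratio_ge_n2 TN d13 E13 isT) (ratio_ge_any TN d41 isT) R7.
  clear; lia.
have nd7 p : sigma_dvd N p 7 -> False.
  by move=> sd; have E := mem 7 (@large_prime_sigma_dvd p 7 isT isT sd) isT isT; rewrite -E in n7.
have [|R13 _] := ratio_ge_even_exp bp13 _ E13.
  by move=> sd; apply: (nd7 13); apply: sigma_dvd_trans sd.
have [|R41 _] := ratio_ge_even_exp bp41 _ E41.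
  by move=> sd; apply: (nd7 41); apply: sigma_dvd_trans sd.
have [r5|/eqP n5] := r =P 5.
  subst r; have [E5|/eqP E5] := logn 5 N =P 2.
    have := LE _ _ _ _ _ _ L13 L41 (@ratio_le_2 N 5 isT E5); clear; lia.
  have := GE _ _ _ _ _ _ R13 R41 (ratio_ge_n2 TN rN E5 isT); clear; lia.
have [r11|/eqP n11] := r =P 11.
  subst r; have [E|/eqP E] := logn 11 N =P 2.
    have := LE _ _ _ _ _ _ L13 L41 (@ratio_le_2 N 11 isT E); clear; lia.
  have [|R11 _] := ratio_ge_even_exp bpr _ E.
    by move=> sd; apply: (not4 bpr bp13 bp41 U'); apply: sigma_dvd_trans sd.
  have := GE _ _ _ _ _ _ R13 R41 R11; clear; lia.
have n13 : r != 13 by move: U; rewrite /= !inE; clear; lia.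
have r17 := large_prime_ge17 bpr n5 n7 n11 n13.
have := LE _ _ _ _ _ _ L13 L41 (ratio_le_any N r_pr r17); clear; lia.
Qed.

(** 5 has exponent 2 and brings in 13; sizes leave 17 or 19 as third prime. Among 5, 13, 17, 19 only
    13 can divide [repunit 3 k], which makes [k] large enough for a sharper bound at 3. *)
Lemma a4_not_dvd5 : 4 < k -> 5 %| N -> False.
Proof.
move=> k5 d5; have R3 := ratio3_even5 k5 Ek.
have bp5 : bp 5 by rewrite /large_prime d5.
have E5 : logn 5 N = 2.
  apply/eqP; apply/negP => /negP E.
  have := triperfect_ge TN (l := [:: (2,27,16); (3,1077,720); (5,6,5)]) isT
    (conj (ratio24 a4).1 (conj R3 (conj (ratio_ge_n2 TN d5 E isT) I))).
  rewrite /nums /dens /=; clear; lia.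
have L5 := @ratio_le_2 N 5 isT E5; have G5 := ratio_ge_any TN d5 isT.
have bp13 := @large_prime_sqr_dvd 5 13 isT E5 isT isT isT.
have d13 : 13 %| N by case/and3P: bp13.
have L13 := @ratio_le_any N 13 13 isT isT.
have E13 : logn 13 N != 2.
  apply/negP => /eqP E; have bp17 := @large_prime_sqr_dvd 13 17 isT E isT isT isT.
  have := le3 bp5 bp13 bp17 isT L5 (@ratio_le_2 N 13 isT E) (@ratio_le_any N 17 17 isT isT).
  clear; lia.
have G13 := ratio_ge_n2 TN d13 E13 isT.
have [r bpr U] := ex_third_prime bp5 bp13 isT L5 L13 ltac:(clear; lia).
have /and3P[r_pr rN r3] := bpr.
have mem s : bp s -> s != 5 -> s != 13 -> s = r.
  move=> bps n1 n2; have := support3_large bp5 bp13 bpr U bps.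
  by rewrite !inE (negPf n1) (negPf n2) => /eqP.
have LE := fun xp yp xq yq xr yr => @le3 5 13 r xp yp xq yq xr yr bp5 bp13 bpr U.
have GE := ge3_gen bp5 bp13 bpr U R3.
have n5 : r != 5 by move: U; rewrite /= !inE; clear; lia.
have n13 : r != 13 by move: U; rewrite /= !inE; clear; lia.
have [r7|/eqP n7] := r =P 7.
  subst r; have [E|/eqP E] := logn 7 N =P 2.
    have := LE _ _ _ _ _ _ L5 L13 (@ratio_le_2 N 7 isT E); clear; lia.
  have := GE _ _ _ _ _ _ G5 G13 (ratio_ge_n2 TN rN E isT); clear; lia.
have [r11|/eqP n11] := r =P 11.
  subst r; have [E|/eqP E] := logn 11 N =P 2.
    have := LE _ _ _ _ _ _ L5 L13 (@ratio_le_2 N 11 isT E); clear; lia.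
  have := GE _ _ _ _ _ _ G5 G13 (ratio_ge_n2 TN rN E isT); clear; lia.
have r17 := large_prime_ge17 bpr n5 n7 n11 n13.
have Er : logn r N != 2.
  apply/negP => /eqP E.
  have := LE _ _ _ _ _ _ L5 L13 (ratio_le_2n r_pr E r17); clear; lia.
have r1719 : r \in [:: 17; 19].
  apply: contraT => rn; have r23 : 23 <= r.
    apply: (@iota_lower_bound 23 (fun x => prime x && (17 <= x) && (x \notin [:: 17; 19]))) => //.
    by rewrite r_pr r17.
  have := LE _ _ _ _ _ _ L5 L13 (ratio_le_any N r_pr r23); clear; lia.
have [p bpp pR] := ex_prime_repunit.
have p13 : p = 13.
  have := repunit3_primes ok pR; rewrite !inE !negb_or => /and4P[p5 _ p17 p19].
  apply/eqP; apply: contraT => n; have E := mem _ bpp p5 n.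
  by move: r1719; rewrite -E !inE (negPf p17) (negPf p19).
have k7 : 6 < k.
  (* 3 has order 3 modulo 13, so 3 divides the odd number [k > 4]. *)
  have M := dvd_repunit_mod (isT : 0 < 3) pR; rewrite p13 in M.
  have := @expn_modP 3 13 3 (fun r x => (r != 0) ==> (x != 1)) k isT (erefl _) isT.
  by rewrite M /=; clear -k5 ok; lia.
have R3' := ratio3_even7 k7 Ek.
have [|R13 _] := ratio_ge_even_exp bp13 _ E13.
  move=> sd; have bp7 : bp 7.
    by apply: (@large_prime_sigma_dvd 13) => //; apply: sigma_dvd_trans sd.
  by have E := mem _ bp7 isT isT; rewrite -E in n7.
have GE' := ge3_gen bp5 bp13 bpr U R3'.
move: r1719; rewrite !inE => /orP[]/eqP E; subst r.
  have := GE' _ _ _ _ _ _ G5 R13 (ratio_ge_n2 TN rN Er isT); clear; lia.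
have [|R19 _] := ratio_ge_even_exp bpr _ Er.
  by move=> sd; apply: (not4 bpr bp5 bp13) => //; apply: sigma_dvd_trans sd.
have := GE' _ _ _ _ _ _ G5 R13 R19; clear; lia.
Qed.

Lemma mod8_cases q : prime q -> q %% 8 = 1 -> [\/ q = 17, q = 41 | 73 <= q].
Proof.
move=> q_pr q8; have [->|/eqP n17] := q =P 17; first by constructor 1.
have [->|/eqP n41] := q =P 41; first by constructor 2.
constructor 3.
apply: (@iota_lower_bound 73 (fun x => (x %% 8 == 1) && prime x && (x \notin [:: 17; 41]))) => //.
by rewrite q_pr q8 !inE (negPf n17) (negPf n41).
Qed.

Lemma mod8_ge17 q : prime q -> q %% 8 = 1 -> 17 <= q.
Proof. by move=> q_pr q8; have [->|->|h] := mod8_cases q_pr q8 => //; apply: leq_trans h. Qed.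

Lemma a4_not_dvd11 q s : 6 < k -> ~~ (5 %| N) -> ~~ (7 %| N) -> bp 11 -> bp q -> bp s ->
  uniq [:: 11; q; s] -> q %% 8 = 1 -> False.
Proof.
move=> k7 n5N n7N bp11 bpq bps U q8; have R3 := ratio3_even7 k7 Ek.
have /and3P[q_pr qN _] := bpq; have /and3P[s_pr sN _] := bps.
have LE := fun xp yp xq yq xr yr => @le3 11 q s xp yp xq yq xr yr bp11 bpq bps U.
have GE := ge3_gen bp11 bpq bps U R3.
have U' : uniq [:: s; 11; q] by move: U; rewrite /= !inE; clear; lia.
have q17 := mod8_ge17 q_pr q8.
have L11 := @ratio_le_any N 11 11 isT isT.
have mem t : bp t -> t != 11 -> t != q -> t = s.
  move=> bpt n1 n2; have := support3_large bp11 bpq bps U bpt.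
  by rewrite !inE (negPf n1) (negPf n2) => /eqP.
have E11 : logn 11 N != 2.
  apply/negP => /eqP E; have bp61 := @large_prime_sqr_dvd 11 61 isT E isT isT isT.
  have n : 61 != q by apply/negP => /eqP E'; rewrite -E' in q8.
  have s61 : 61 <= s by rewrite -(mem _ bp61 isT n).
  have := LE _ _ _ _ _ _ (@ratio_le_2 N 11 isT E) (ratio_le_any N q_pr q17)
    (ratio_le_any N s_pr s61).
  clear; lia.
have [|G11 [m [om m3 Em]]] := ratio_ge_even_exp bp11 _ E11.
  by move=> sd; apply: (not4 bp11 bpq bps U); apply: sigma_dvd_trans sd.
have sdR11 d : d %| repunit 11 m -> sigma_dvd N 11 d.
  by move=> dd; split=> //; rewrite Em sigma_even ?dvdn_mulr //; clear -m3; lia.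
have n11 : s != 11 by move: U; rewrite /= !inE; clear; lia.
have n5 : s != 5 by apply: contraNneq n5N => <-.
have n7 : s != 7 by apply: contraNneq n7N => <-.
have n13 : s != 13.
  apply/negP => /eqP E; subst s.
  have E13 : logn 13 N != 2.
    apply: contraNneq n5N => E; have := @large_prime_sqr_dvd 13 5 isT E isT isT isT.
    by case/and3P.
  have [|G13 _] := ratio_ge_even_exp bps _ E13.
    move=> sd; move/negP: n7N; apply; apply: (dvd_prime_gt3 TN (p := 13)) => //.
    by apply: sigma_dvd_trans sd.
  have := GE _ _ _ _ _ _ G11 (ratio_ge_1 N q_pr) G13; clear; lia.
have s17 := large_prime_ge17 bps n5 n7 n11 n13.
have E17 : logn 17 N != 2.
  apply: contraNneq n5N => E; have := @large_prime_sqr_dvd 17 5 isT E isT isT isT.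
  by case/and3P.
have q41_case : q = 17 \/ 41 <= q.
  by have [->|->|h] := mod8_cases q_pr q8; [left|right|right; move: h; clear; lia].
case: q41_case => [Eq|q41].
  subst q; have G17 := ratio_ge_n2 TN qN E17 isT.
  have s19 : 19 <= s.
    apply: (@iota_lower_bound 19 (fun x => prime x && (17 <= x) && (x != 17))) => //.
    by rewrite s_pr s17 /=; move: U; rewrite /= !inE; clear; lia.
  have L17 := @ratio_le_any N 17 17 isT isT.
  have Es : logn s N != 2.
    apply/negP => /eqP E; have := LE _ _ _ _ _ _ L11 L17 (ratio_le_2n s_pr E s19).
    clear; lia.
  have s_lo : 54 <= s.
    have := GE _ _ _ _ _ _ G11 G17 (ratio_ge_n2 TN sN Es s_pr); clear; lia.
  have s_hi : s <= 72.
    have := LE _ _ _ _ _ _ L11 L17 (ratio_le_any N s_pr (leqnn s)).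
    clear -s17; lia.
  have : s \in [:: 59; 61; 67; 71].
    apply: (@iota_forall 73 (fun x => prime x && (54 <= x)) (fun x => x \in [:: 59; 61; 67; 71])) => //.
    by rewrite s_pr s_lo.
  (* A prime of [repunit 11 m] must be 11, 17 or [s]. But [m] is odd, while the order of 11 is even
     modulo 17, 59, 61, 67 and 71. *)
  have r_gt1 : 1 < repunit 11 m by apply: leq_trans (repunit_ge2 11 (ltnW m3)).
  have w_pr := pdiv_prime r_gt1; have wR := pdiv_dvd (repunit 11 m).
  move: (pdiv _) w_pr wR => w w_pr wR.
  have M := dvd_repunit_mod (isT : 0 < 11) wR.
  have w3 : 3 < w.
    apply: (prime_gt3 w_pr wR); first by rewrite odd_repunit.
    apply/negP => /(dvd_repunit_mod (isT : 0 < 11)).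
    have := @expn_modP 11 3 2 (fun r x => odd r ==> (x != 1)) m isT (erefl _) isT.
    by rewrite oddn_mod // om /= => /eqP.
  have bpw := large_prime_sigma_dvd w_pr w3 (sdR11 _ wR).
  have w11 : w != 11.
    apply/negP => /eqP E; subst w; move: M; case: (m) om => // m' _.
    by rewrite expnS modnMr.
  have wn17 : w != 17.
    apply/negP => /eqP E; subst w.
    have := @expn_modP 11 17 16 (fun r x => odd r ==> (x != 1)) m isT (erefl _) isT.
    by rewrite oddn_mod // om M.
  have Ew := mem _ bpw w11 wn17; rewrite Ew in M.
  rewrite !inE => /or4P[]/eqP E; rewrite E in M.
  - have := @expn_modP 11 59 58 (fun r x => odd r ==> (x != 1)) m isT (erefl _) isT.
    by rewrite oddn_mod // om M.
  - have := @expn_modP 11 61 4 (fun r x => odd r ==> (x != 1)) m isT (erefl _) isT.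
    by rewrite oddn_mod // om M.
  - have := @expn_modP 11 67 66 (fun r x => odd r ==> (x != 1)) m isT (erefl _) isT.
    by rewrite oddn_mod // om M.
  - have := @expn_modP 11 71 70 (fun r x => odd r ==> (x != 1)) m isT (erefl _) isT.
    by rewrite oddn_mod // om M.
have L41 := ratio_le_any N q_pr q41.
have s_hi : s <= 20.
  have := LE _ _ _ _ _ _ L11 L41 (ratio_le_any N s_pr (leqnn s)).
  clear -s17; lia.
have : s \in [:: 17; 19].
  apply: (@iota_forall 21 (fun x => prime x && (17 <= x)) (fun x => x \in [:: 17; 19])) => //.
  by rewrite s_pr s17.
rewrite !inE => /orP[]/eqP E; subst s.
  have G17 := ratio_ge_n2 TN sN E17 isT.
  have L17 := @ratio_le_any N 17 17 isT isT.
  have [E|/eqP E] := logn q N =P 2.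
    have := LE _ _ _ _ _ _ L11 (ratio_le_2n q_pr E q41) L17; clear; lia.
  have q54 : 54 <= q.
    have := GE _ _ _ _ _ _ G11 (ratio_ge_n2 TN qN E q_pr) G17; clear; lia.
  have [Eq|Eq|q73] := mod8_cases q_pr q8; [by move: q54; rewrite Eq|by move: q54; rewrite Eq|].
  have := LE _ _ _ _ _ _ L11 (ratio_le_any N q_pr q73) L17; clear; lia.
have E19 : logn 19 N != 2.
  apply/negP => /eqP E; have := LE _ _ _ _ _ _ L11 L41 (@ratio_le_2 N 19 isT E); clear; lia.
have [|G19 _] := ratio_ge_even_exp bps _ E19.
  by move=> sd; apply: (not4 bps bp11 bpq U'); apply: sigma_dvd_trans sd.
have L19 := @ratio_le_any N 19 19 isT isT.
have [Eq|Eq|q73] := mod8_cases q_pr q8; first by move: q41; rewrite Eq.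
  subst q; have [E|/eqP E] := logn 41 N =P 2.
    have := LE _ _ _ _ _ _ L11 (@ratio_le_2 N 41 isT E) L19; clear; lia.
  have := GE _ _ _ _ _ _ G11 (ratio_ge_n2 TN qN E isT) G19; clear; lia.
have := LE _ _ _ _ _ _ L11 (ratio_le_any N q_pr q73) L19; clear; lia.
Qed.

(** Sizes force [q = 17] and [s = 31]; then no prime is left for [(13 ^ m.+1 + 1) / 2]. *)
Lemma a4_not_dvd13 q s : 6 < k -> ~~ (5 %| N) -> ~~ (7 %| N) -> ~~ (11 %| N) ->
  bp 13 -> bp q -> bp s -> uniq [:: 13; q; s] -> q %% 8 = 1 -> False.
Proof.
move=> k7 n5N n7N n11N bp13 bpq bps U q8; have R3 := ratio3_even7 k7 Ek.
have /and3P[q_pr qN _] := bpq; have /and3P[s_pr sN _] := bps.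
have LE := fun xp yp xq yq xr yr => @le3 13 q s xp yp xq yq xr yr bp13 bpq bps U.
have GE := ge3_gen bp13 bpq bps U R3.
have L13 := @ratio_le_any N 13 13 isT isT.
have E13 : logn 13 N != 2.
  apply: contraNneq n5N => E; have := @large_prime_sqr_dvd 13 5 isT E isT isT isT.
  by case/and3P.
have [|G13 [m [om m3 Em]]] := ratio_ge_even_exp bp13 _ E13.
  move=> sd; move/negP: n7N; apply; apply: (dvd_prime_gt3 TN (p := 13)) => //.
  by apply: sigma_dvd_trans sd.
have sdS13 d : d %| (13 ^ m.+1).+1 -> sigma_dvd N 13 d.
  by move=> dd; split=> //; rewrite Em sigma_even ?dvdn_mull //; clear -m3; lia.
have n13 : s != 13 by move: U; rewrite /= !inE; clear; lia.
have n5 : s != 5 by apply: contraNneq n5N => <-.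
have n7 : s != 7 by apply: contraNneq n7N => <-.
have n11 : s != 11 by apply: contraNneq n11N => <-.
have s17 := large_prime_ge17 bps n5 n7 n11 n13.
have q41_case : q = 17 \/ 41 <= q.
  by have [->|->|h] := mod8_cases q_pr q8; [left|right|right; move: h; clear; lia].
case: q41_case => [Eq|q41]; last first.
  have := LE _ _ _ _ _ _ L13 (ratio_le_any N q_pr q41) (ratio_le_any N s_pr s17); clear; lia.
subst q.
have E17 : logn 17 N != 2.
  apply: contraNneq n5N => E; have := @large_prime_sqr_dvd 17 5 isT E isT isT isT.
  by case/and3P.
have G17 := ratio_ge_n2 TN qN E17 isT.
have L17 := @ratio_le_any N 17 17 isT isT.
have s19 : 19 <= s.
  apply: (@iota_lower_bound 19 (fun x => prime x && (17 <= x) && (x != 17))) => //.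
  by rewrite s_pr s17 /=; move: U; rewrite /= !inE; clear; lia.
have Es : logn s N != 2.
  apply/negP => /eqP E; have := LE _ _ _ _ _ _ L13 L17 (ratio_le_2n s_pr E s19).
  clear; lia.
have s_lo : 30 <= s.
  have := GE _ _ _ _ _ _ G13 G17 (ratio_ge_n2 TN sN Es s_pr); clear; lia.
have s_hi : s <= 34.
  have := LE _ _ _ _ _ _ L13 L17 (ratio_le_any N s_pr (leqnn s)).
  clear -s17; lia.
have s31 : s = 31.
  apply/eqP; apply: (@iota_forall 35 (fun x => prime x && (30 <= x)) (pred1 31)) => //.
  by rewrite s_pr s_lo.
subst s.
have m4 : m %% 4 = 3.
  have [E|//] : m %% 4 = 1 \/ m %% 4 = 3 by clear -om; lia.
  have M1 : m.+1 %% 4 = 2 by clear -E; lia.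
  exfalso; move/negP: n5N; apply; apply: (dvd_prime_gt3 TN (p := 13)) => //.
  apply: sdS13; apply: mod_dvd_expS => //.
  have := @expn_modP 13 5 4 (fun r x => (r == 2) ==> (x == 4)) m.+1 isT (erefl _) isT.
  by rewrite M1 /= => /eqP.
(* 13 has order 4 modulo 17, so the power is 1 there; modulo 31 it is a square, and -1 is not. *)
have m14 : m.+1 %% 4 = 0 by clear -m4; lia.
have om1 : ~~ odd m.+1 by rewrite /= om.
have [|||u [u_pr ud u3]] := @expS_half_prime (13 ^ m.+1).
- by apply: leq_trans (ltn_expl _ (isT : 1 < 13)).
- by rewrite -modnXm exp1n.
- by rewrite -modnXm exp1n.
have bpu := large_prime_sigma_dvd u_pr u3 (sdS13 _ ud).
have M := dvd_expS_mod (prime_gt0 u_pr) ud.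
have := support3_large bp13 bpq bps U bpu; rewrite !inE => /or3P[]/eqP E; rewrite E in M.
- by move: M; rewrite expnS modnMr.
- have := @expn_modP 13 17 4 (fun r x => (r == 0) ==> (x == 1)) m.+1 isT (erefl _) isT.
  by rewrite m14 M.
- have := @expn_modP 13 31 30 (fun r x => ~~ odd r ==> (x != 30)) m.+1 isT (erefl _) isT.
  by rewrite oddn_mod // om1 M.
Qed.

(* Here [repunit 3 k] and [repunit 7 m] turn out to be powers of the same prime [p];
   modulo 8 the latter is a square, which is impossible modulo 5. *)
Lemma a4_not_dvd7 p q : k %% 4 = 3 -> ~~ (5 %| N) -> bp 7 -> bp p -> bp q ->
  uniq [:: 7; p; q] -> p %| repunit 3 k -> q %| (3 ^ k.+1).+1 -> q %% 8 = 1 -> False.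
Proof.
move=> k4 n5N bp7 bpp bpq U pR qS q8.
have /and3P[p_pr pN p3] := bpp; have /and3P[q_pr qN q3] := bpq.
have E7 : logn 7 N != 2.
  apply: contraNneq n5N => E; have := @large_prime_sqr_dvd 7 5 isT E isT isT isT.
  by case/and3P.
have [|_ [m [om m3 Em]]] := ratio_ge_even_exp bp7 _ E7.
  by move=> sd; apply: (not4 bp7 bpp bpq U); apply: sigma_dvd_trans sd.
have m_gt0 : 0 < m by apply: ltnW; apply: ltnW.
have sdR7 d : d %| repunit 7 m -> sigma_dvd N 7 d.
  by move=> dd; split=> //; rewrite Em sigma_even ?dvdn_mulr.
have sdS7 d : d %| (7 ^ m.+1).+1 -> sigma_dvd N 7 d.
  by move=> dd; split=> //; rewrite Em sigma_even ?dvdn_mull.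
have m4 : m %% 4 = 3.
  have [E|//] : m %% 4 = 1 \/ m %% 4 = 3 by clear -om; lia.
  have M1 : m.+1 %% 4 = 2 by clear -E; lia.
  exfalso; move/negP: n5N; apply; apply: (dvd_prime_gt3 TN (p := 7)) => //.
  apply: sdS7; apply: mod_dvd_expS => //.
  have := @expn_modP 7 5 4 (fun r x => (r == 2) ==> (x == 4)) m.+1 isT (erefl _) isT.
  by rewrite M1 /= => /eqP.
have op : odd p by case: (even_prime p_pr) => // E; rewrite E in p3.
(* [3 ^ k] is 11 modulo 16, so [repunit 3 k], a power of [p], is 5 modulo 8. *)
have p8 : p %% 8 = 5.
  have [x Ex] : exists x, repunit 3 k = p ^ x.
    apply: prime_power; first exact: repunit_gt0 (ltnW k_gt1).
    move=> t t_pr tR; have bpt := repunit_large_prime t_pr tR.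
    have t3 : 3 < t by case/and3P: bpt.
    have tq := repunit_expS_neq t3 tR qS.
    have t7 : t != 7 by have := repunit3_primes ok tR; rewrite !inE !negb_or => /and4P[].
    have := support3_large bp7 bpp bpq U bpt.
    by rewrite !inE (negPf t7) (negPf tq) orbF => /eqP.
  apply: (power_mod8 op (x := x)); rewrite -Ex.
  have := @expn_modP 3 16 4 (fun r x => (r == 3) ==> (x == 11)) k isT (erefl _) isT.
  rewrite k4 /= => /eqP; rewrite -repunit3; clear; lia.
(* A prime above 3 dividing this is 1 modulo 8, which 7 and [p] are not. *)
have qS7 : q %| (7 ^ m.+1).+1.
  have [|||u [u_pr ud u3]] := @expS_half_prime (7 ^ m.+1).
  - by apply: leq_trans (ltn_expl _ (isT : 1 < 7)).
  - have := @expn_modP 7 4 2 (fun r x => ~~ odd r ==> (x == 1)) m.+1 isT (erefl _) isT.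
    by rewrite oddn_mod //= om => /eqP.
  - by rewrite -modnXm exp1n.
  have ou : odd u by case: (even_prime u_pr) => // E; rewrite E in u3.
  have u8 : u %% 8 = 1.
    apply: (@dvd_quartic_mod8 u (7 ^ (m.+1 %/ 4))) => //.
    by rewrite -expnM divnK //; clear -m4; lia.
  have bpu := large_prime_sigma_dvd u_pr u3 (sdS7 _ ud).
  have := support3_large bp7 bpp bpq U bpu; rewrite !inE => /or3P[]/eqP E.
  - by rewrite E in u8.
  - by rewrite E p8 in u8.
  - by rewrite -E.
have q_nR : ~~ (q %| repunit 7 m).
  apply/negP => /(dvd_repunit_mod (isT : 0 < 7)) M.
  have := dvd_expS_mod (prime_gt0 q_pr) qS7.
  rewrite expnS -modnMmr M modnMmr muln1.
  have q17 := mod8_ge17 q_pr q8.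
  by rewrite modn_small; clear -q17; lia.
have [i Ei] : exists i, repunit 7 m = p ^ i.
  apply: prime_power; first exact: repunit_gt0.
  move=> t t_pr tR.
  have or : odd (repunit 7 m) by rewrite odd_repunit.
  have r3 : ~~ (3 %| repunit 7 m).
    apply/negP => d3.
    have M9 : 7 ^ m %% 9 = 1.
      by case/dvdnP: d3 => c Ec; rewrite -(@repunitE 7) // Ec; clear; lia.
    have m_3 : m %% 3 = 0.
      have := @expn_modP 7 9 3 (fun r x => (r != 0) ==> (x != 1)) m isT (erefl _) isT.
      by rewrite M9 /=; case: (m %% 3).
    have bp19 : bp 19.
      apply: (@large_prime_sigma_dvd 7) => //; apply: sdR7; apply: mod_dvd_repunit => //.
      have := @expn_modP 7 19 3 (fun r x => (r == 0) ==> (x == 1)) m isT (erefl _) isT.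
      by rewrite m_3 /= => /eqP.
    have := support3_large bp7 bpp bpq U bp19; rewrite !inE => /or3P[]/eqP E //.
    - by have := repunit3_primes ok pR; rewrite -E.
    - by rewrite -E in q8.
  have t3 := prime_gt3 t_pr tR or r3.
  have bpt := large_prime_sigma_dvd t_pr t3 (sdR7 _ tR).
  have := support3_large bp7 bpp bpq U bpt; rewrite !inE => /or3P[]/eqP E //.
    have := dvd_repunit_mod (isT : 0 < 7) tR; rewrite E.
    by case: (m) m_gt0 => // m' _; rewrite expnS modnMr.
  by move: q_nR; rewrite -E tR.
have M48 : repunit 7 m %% 8 = 1.
  have := @expn_modP 7 48 2 (fun r x => odd r ==> (x == 7)) m isT (erefl _) isT.
  rewrite oddn_mod // om /= => /eqP; rewrite -(@repunitE 7) //; clear; lia.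
have M5 : repunit 7 m %% 5 = 2.
  have := @expn_modP 7 5 4 (fun r x => (r == 3) ==> (x == 3)) m isT (erefl _) isT.
  rewrite m4 /= => /eqP; rewrite -(@repunitE 7) //; clear; lia.
(* So [repunit 7 m = p ^ i] is a square, while it is 2 modulo 5, a nonresidue. *)
have oi := power_mod8_even p8 (etrans (congr1 (modn^~ 8) (esym Ei)) M48).
move: M5; rewrite Ei -(odd_double_half i) (negPf oi) add0n double_exp.
move: (p ^ _) => y; rewrite -modnMml -modnMmr.
have : y %% 5 < 5 by rewrite ltn_mod.
by case: (y %% 5) => [|[|[|[|[|]]]]].
Qed.

(** Excluding 5 makes [3 ^ k.+1] a fourth power, so [q] is 1 modulo 8. With 7, 11 and 13 also gone,
    three primes are too large to reach 3. *)
Lemma a4_logn3_mod4_2 : False.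
Proof.
have [k3|k3] : k = 3 \/ 4 < k by have := k_gt1; clear -ok; lia.
  exact: a4_logn3_neq6.
have [d5|n5N] := boolP (5 %| N); first exact: a4_not_dvd5.
have k4 : k %% 4 = 3.
  have [E|//] : k %% 4 = 1 \/ k %% 4 = 3 by clear -ok; lia.
  have M1 : k.+1 %% 4 = 2 by clear -E; lia.
  exfalso; move/negP: n5N; apply; apply: (dvd_prime_gt3 TN (p := 3)) => //.
  apply: sigma_dvd_expS; apply: mod_dvd_expS => //.
  have := @expn_modP 3 5 4 (fun r x => (r == 2) ==> (x == 4)) k.+1 isT (erefl _) isT.
  by rewrite M1 /= => /eqP.
have k7 : 6 < k by clear -k3 k4; lia.
have [p bpp pR] := ex_prime_repunit; have [q bpq qS] := ex_prime_expS.
have /and3P[p_pr pN p3] := bpp; have /and3P[q_pr qN q3] := bpq.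
have pq := repunit_expS_neq p3 pR qS.
have q8 : q %% 8 = 1.
  apply: (@dvd_quartic_mod8 q (3 ^ (k.+1 %/ 4))) => //.
    by case: (even_prime q_pr) => // E; rewrite E in q3.
  by rewrite -expnM divnK //; clear -k4; lia.
have := repunit3_primes ok pR; rewrite !inE !negb_or => /and4P[p5 p7 p17 p19].
have p11 := large_prime_ge11 bpp p5 p7.
have q17 := mod8_ge17 q_pr q8.
have [r bpr U] := ex_third_prime bpp bpq pq (ratio_le_any N p_pr p11) (ratio_le_any N q_pr q17)
  ltac:(clear; lia).
have /and3P[r_pr rN r3] := bpr.
have [r7|/eqP r7] := r =P 7.
  subst r; apply: (a4_not_dvd7 (p := p) (q := q) k4 n5N) => //.
  by move: U; rewrite /= !inE; clear; lia.
have mem t : bp t -> t \in [:: p; q; r] by exact: support3_large.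
have qn t : t %% 8 != 1 -> t != q by move=> h; apply: contraNneq h => ->; rewrite q8.
have n7N : ~~ (7 %| N).
  apply/negP => d7; have := mem 7; rewrite /large_prime d7 !inE => /(_ isT).
  by rewrite eq_sym (negPf p7) (negPf (qn 7 isT)) eq_sym (negPf r7).
have [d11|n11N] := boolP (11 %| N).
  have bp11 : bp 11 by rewrite /large_prime d11.
  have := mem _ bp11; rewrite !inE (negPf (qn 11 isT)) => /orP[]/eqP E.
    by subst p; apply: (a4_not_dvd11 (q := q) (s := r)).
  subst r; apply: (a4_not_dvd11 (q := q) (s := p)) => //.
  by move: U; rewrite /= !inE; clear; lia.
have [d13|n13N] := boolP (13 %| N).
  have bp13 : bp 13 by rewrite /large_prime d13.
  have := mem _ bp13; rewrite !inE (negPf (qn 13 isT)) => /orP[]/eqP E.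
    by subst p; apply: (a4_not_dvd13 (q := q) (s := r)).
  subst r; apply: (a4_not_dvd13 (q := q) (s := p)) => //.
  by move: U; rewrite /= !inE; clear; lia.
have p11' : p != 11 by apply: contraNneq n11N => <-.
have p13' : p != 13 by apply: contraNneq n13N => <-.
have p23 : 23 <= p.
  apply: (@iota_lower_bound 23 (fun x => prime x && (11 <= x) && (x \notin [:: 11; 13; 17; 19]))) => //.
  by rewrite p_pr p11 !inE (negPf p11') (negPf p13') (negPf p17) (negPf p19).
have r17 : 17 <= r.
  by apply: large_prime_ge17 => //; [apply: contraNneq n5N | apply: contraNneq n11N | apply: contraNneq n13N] => <-.
have q41_case : q = 17 \/ 41 <= q.
  by have [->|->|h] := mod8_cases q_pr q8; [left|right|right; move: h; clear; lia].
case: q41_case => [Eq|q41].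
  subst q; have r19 : 19 <= r.
    apply: (@iota_lower_bound 19 (fun x => prime x && (17 <= x) && (x != 17))) => //.
    by rewrite r_pr r17 /=; move: U; rewrite /= !inE; clear; lia.
  have := le3 bpp bpq bpr U (ratio_le_any N p_pr p23) (ratio_le_any N q_pr (leqnn 17))
    (ratio_le_any N r_pr r19).
  clear; lia.
have := le3 bpp bpq bpr U (ratio_le_any N p_pr p23) (ratio_le_any N q_pr q41)
  (ratio_le_any N r_pr r17).
clear; lia.
Qed.

End FourOdd.

(** * Assembly of the cases, and verification of 2160 *)

Lemma triperfect_27_eq N : triperfect N -> 2 < logn 3 N -> N = 2160.
Proof.
move=> TN b3; have logn2_gt2 := logn2_gt2 TN b3; have logn2_neq3 := logn2_neq3 TN b3.
have [a4|a5] : logn 2 N = 4 \/ 4 < logn 2 N by clear -logn2_gt2 logn2_neq3; lia.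
  have [b_eq3|b_neq3] := eqVneq (logn 3 N) 3; first exact: (a4_logn3_eq3 TN a4).
  exfalso; case: (even_or_odd (logn 3 N)) => [[k Ek]|[k Ek]].
    by case: (boolP (odd k)) => ok; [apply: (a4_logn3_mod4_2 TN a4 b3 Ek) | apply: (a4_logn3_mod4_0 TN a4 b3 Ek)].
  have b5 : 4 < logn 3 N by move: b3 b_neq3; rewrite Ek; clear; lia.
  by case: (boolP (odd k)) => ok; [apply: (a4_logn3_mod4_3 TN a4 b3 b5 Ek) | apply: (a4_logn3_mod4_1 TN a4 b3 b5 Ek)].
exfalso; have [b_eq3|[b_eq4|b5]] : logn 3 N = 3 \/ logn 3 N = 4 \/ 4 < logn 3 N by clear -b3; lia.
- exact: (logn3_neq3 TN b3 a5).
- exact: (logn3_neq4 TN b3 a5).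
exact: (large_absurd TN a5 b5).
Qed.

Theorem theorem1p1 (N : nat) :
  [/\ 0 < N, 27 %| N & sigma_biunitary N = 3 * N] <-> N = 2160.
Proof.
split=> [[N_gt0 d27 sN]|->].
  by apply: triperfect_27_eq => //; rewrite -pfactor_dvdn.
have E : 2160 = 2 ^ 4 * (3 ^ 3 * 5 ^ 1) by vm_compute.
split=> //.
have -> : sigma_biunitary 2160 = 27 * (40 * 6); last by vm_compute.
rewrite E sigma_biunitaryM // sigma_biunitaryM // sigma_2_4 sigma_3_3.
by rewrite (@sigma_odd 5 0) // /repunit big_ord1.
Qed.
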